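(* Let $\mathfrak A$ be projective and spanning, let $P$ be a homogeneous polynomial of degree $d$ in $n$ variables, and let $(\lambda_1,\dots,\lambda_r)$ be a positively oriented $\mathbb Z$-basis of $\Gamma_{\mathfrak a}$. Let $z\in(\mathbb C^* )^n$ be such that the set $O_{\mathfrak B}(z)\subset U(\mathfrak A)$ is finite and the function $(1-\kappa)D^{\mathfrak B}(\alpha_1,\dots,\alpha_n)$ does not vanish on it, and let $U(z)$ be a (sufficiently) small neighborhood of $O_{\mathfrak B}(z)$ in $U(\mathfrak A)$. Then for sufficiently small $\delta>0$ $$\langle P\rangle_{\mathfrak B}(z)=\frac1{(2\pi\sqrt{-1})^r}\int_{Z_\delta\cap U(z)}\frac{P(\alpha_1,\dots,\alpha_n)\prod_{j=1}^rp_j\;d\mu}{(1-\kappa)\prod_{i=1}^n\alpha_i\prod_{j=1}^r(p_j-q_j)},$$ where $Z_\delta=\{u\in U(\mathfrak A):|p_j(u)-q_j|=\delta,\ j=1,\dots,r\}$ is oriented by the form $d\arg(p_1-q_1)\wedge\dots\wedge d\arg(p_r-q_r)$.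
   Context: Setting. Let $0\to\mathfrak a\to\mathfrak g\xrightarrow{\pi}\mathfrak t\to0$ be an exact sequence of real vector spaces of dimensions $r,n,d$, where $\mathfrak g=\bigoplus_{i=1}^n\mathbb R\omega_i$ has lattice $\Gamma_{\mathfrak g}=\bigoplus\mathbb Z\omega_i$; assume $\Gamma_{\mathfrak a}=\Gamma_{\mathfrak g}\cap\mathfrak a$ has full rank in $\mathfrak a$ and put $\Gamma_{\mathfrak t}=\pi(\Gamma_{\mathfrak g})$. Let $\Gamma^*_{\mathfrak a},\Gamma_{\mathfrak t}^*$ be the dual lattices, $\mu:\mathfrak g^*\to\mathfrak a^*$ the dual map, $(\omega^i)$ the dual basis, $\alpha_i=\mu(\omega^i)$, $\beta_i=\pi(\omega_i)$, $\mathfrak A=[\alpha_1,\dots,\alpha_n]$, $\mathfrak B=[\beta_1,\dots,\beta_n]$; the $\alpha_i$ generate $\Gamma_{\mathfrak a}^*$ over $\mathbb Z$; $\kappa=\sum_i\alpha_i$. $\mathfrak A$ is projective if it lies in an open (linear) half space of $\mathfrak a^*$; it is spanning if for every $k$ one can write $\kappa=\sum_i t_i\alpha_i$ with $t_i\ge0$, $t_k=0$, $t_i\ne0$ for $i\neq k$. $\mathfrak a$ is oriented and $d\mu$ is the translation invariant holomorphic volume form on $\mathfrak a_{\mathbb C}$ determined by the orientation and $\Gamma_{\mathfrak a}$ (signed unit volume on a fundamental parallelepiped). $U(\mathfrak A)=\{u\in\mathfrak a_{\mathbb C}:\alpha_i(u)\ne0\ \forall i\}$. $p_j(u)=\prod_i\alpha_i(u)^{\langle\alpha_i,\lambda_j\rangle}$,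 $q_j=\prod_iz_i^{\langle\alpha_i,\lambda_j\rangle}$. B-side. Fix a $\mathbb Z$-basis $(h_1,\dots,h_d)$ of $\Gamma^*_{\mathfrak t}$ and let $D^{\mathfrak B}(x)=\det\big(\sum_{i}\langle h_j,\beta_i\rangle\langle h_k,\beta_i\rangle x_i\big)_{j,k=1}^d$. On $T=\mathfrak t^*_{\mathbb C}/\Gamma_{\mathfrak t}^*$, with $e_\beta(w)=e^{2\pi\sqrt{-1}\langle w,\beta\rangle}$, put $f=1-\sum_iz_ie_{\beta_i}$, $H_f=D^{\mathfrak B}(z_1e_{\beta_1},\dots,z_ne_{\beta_n})$, $\tilde P=P(z_1e_{\beta_1},\dots,z_ne_{\beta_n})$ and $O_{\mathfrak B}(z)=\{w\in T:\sum_iz_i\langle h_k,\beta_i\rangle e_{\beta_i}(w)=0,\ k=1,\dots,d\}$. Then $$\langle P\rangle_{\mathfrak B}(z)=\sum_{w\in O_{\mathfrak B}(z)}\frac{\tilde P(w)}{f(w)H_f(w)}.$$ $O_{\mathfrak B}(z)$ is regarded as a subset of $U(\mathfrak A)$ via $w\mapsto(z_1e_{\beta_1}(w),\dots,z_ne_{\beta_n}(w))\in\mathfrak g_{\mathbb C}\cong\mathbb C^n$, where $\mathfrak a_{\mathbb C}\subset\mathfrak g_{\mathbb C}$ by $u\mapsto(\alpha_1(u),\dots,\alpha_n(u))$; it is then the set $\{u\in U(\mathfrak A):p_j(u)=q_j,\ j=1,\dots,r\}$. *)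

(* Defs.v *)
From HB Require Import structures.
From mathcomp Require Import all_boot all_order all_algebra generic_quotient.
From mathcomp Require Import all_classical all_reals all_analysis.
From mathcomp Require Export complex.
From mathcomp Require mpoly.

Set Implicit Arguments.
Unset Strict Implicit.
Unset Printing Implicit Defensive.

Import Order.TTheory GRing.Theory Num.Theory numFieldNormedType.Exports.

Local Open Scope classical_set_scope.
Local Open Scope ring_scope.
Local Open Scope complex_scope.
Local Open Scope quotient_scope.

(** * Lattices *)

Definition Zspan (R : realType) (V : vectType R) (k : nat) (b : k.-tuple V)
    : set V :=
  [set v | exists c : 'I_k -> int, v = \sum_i tnth b i *~ c i].

Definition is_Zbasis (R : realType) (V : vectType R) (Gamma : set V) (k : nat)
    (b : k.-tuple V) : Prop :=
  Zspan b = Gamma /\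
  (forall c : 'I_k -> int,
     \sum_i tnth b i *~ c i = 0 -> forall i, c i = 0).

Definition dual_lattice (R : realType) (V : vectType R) (Gamma : set V)
    : set 'Hom(V, R^o) :=
  [set l | forall x, Gamma x -> (l x : R) \is a Num.int].

Definition full_rank (R : realType) (V : vectType R) (k : nat) (Gamma : set V)
    : Prop :=
  exists2 b : k.-tuple V, basis_of fullv b & forall i, Gamma (tnth b i).

(** The exact sequence 0 -> a -> g -> t -> 0 of real vector spaces of
    dimensions r, n, d, with the chosen basis omega of g. *)
Record lattice_seq (R : realType) (r n d : nat) := LatticeSeq {
  sp_a : vectType R;
  sp_g : vectType R;
  sp_t : vectType R;
  iota : 'Hom(sp_a, sp_g);
  proj : 'Hom(sp_g, sp_t);
  omega : n.-tuple sp_g;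
  dim_a : \dim (fullv : {vspace sp_a}) = r;
  dim_t : \dim (fullv : {vspace sp_t}) = d;
  omega_basis : basis_of fullv omega;
  iota_inj : lker iota = 0%VS;
  iota_proj_exact : limg iota = lker proj;
  proj_surj : limg proj = fullv;
  a_full_rank : full_rank r (iota @^-1` Zspan omega)
}.

Section Sequence.
Variables (R : realType) (r n d : nat) (S : lattice_seq R r n d).
Local Notation C := R[i].
Local Notation a := (sp_a S).
Local Notation g := (sp_g S).
Local Notation t := (sp_t S).

Definition Gamma_g : set g := Zspan (omega S).
Definition Gamma_a : set a := iota S @^-1` Gamma_g.
Definition Gamma_t : set t := proj S @` Gamma_g.

Definition mu (l : 'Hom(g, R^o)) : 'Hom(a, R^o) := (l \o iota S)%VF.
Definition omega_dual (i : 'I_n) : 'Hom(g, R^o) := linfun (coord (omega S) i).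
Definition alpha (i : 'I_n) : 'Hom(a, R^o) := mu (omega_dual i).
Definition beta (i : 'I_n) : t := proj S (tnth (omega S) i).
Definition kappa : 'Hom(a, R^o) := \sum_i alpha i.

Definition projective : Prop :=
  exists2 l : 'Hom('Hom(a, R^o), R^o), l != 0 &
    forall i, 0 < (l (alpha i) : R).

Definition spanning : Prop :=
  forall k : 'I_n, exists c : 'I_n -> R,
    [/\ kappa = \sum_i c i *: alpha i, forall i, 0 <= c i, c k = 0
      & forall i, i != k -> c i != 0].

(** Two bases of a define the same orientation. *)
Definition same_orientation (e lam : r.-tuple a) : Prop :=
  0 < \det (\matrix_(j < r, k < r) (coord e k (tnth lam j) : R)).

(** The integer <alpha_i, lam_j>, for lam_j in Gamma_a. *)
Definition pairing (lam : r.-tuple a) (i : 'I_n) (j : 'I_r) : int :=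
  Num.floor (alpha i (tnth lam j) : R).

(** ** The complexification of a

    A basis e of a identifies the complexification of a with C^r: the row u
    stands for \sum_j u_j e_j.  If e is a Z-basis of Gamma_a which represents
    the chosen orientation of a, then the volume form dmu takes the value 1 on
    (e_1, ..., e_r), that is, it is the determinant in these coordinates. *)
Definition dmu (v : 'M[C]_r) : C := \det v.

Section Complexified.
Variable e : r.-tuple a.
Implicit Type u : 'rV[C]_r.

(** The C-linear extension of a real linear form. *)
Definition cform (l : 'Hom(a, R^o)) u : C :=
  \sum_j (l (tnth e j) : R)%:C * u 0 j.

Definition U_A : set 'rV[C]_r := [set u | forall i, cform (alpha i) u != 0].

Definition p_ (lam : r.-tuple a) (j : 'I_r) u : C :=
  \prod_i cform (alpha i) u ^ pairing lam i j.

Definition q_ (lam : r.-tuple a) (z : 'I_n -> C) (j : 'I_r) : C :=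
  \prod_i z i ^ pairing lam i j.

Definition Z_ (lam : r.-tuple a) (z : 'I_n -> C) (delta : R) : set 'rV[C]_r :=
  [set u | U_A u /\ forall j, `|p_ lam j u - q_ lam z j| = delta%:C].

(** d arg F = Im (dF / F), for F = p_j - q_j. *)
Definition darg (lam : r.-tuple a) (z : 'I_n -> C) (j : 'I_r)
    (u v : 'rV[C]_r) : R :=
  complex.Im ((('D_v (p_ lam j : 'rV[C]_r -> C^o) u : C)
                      / (p_ lam j u - q_ lam z j))).

(** The wedge product of the d arg (p_j - q_j), evaluated on the rows of v. *)
Definition darg_wedge (lam : r.-tuple a) (z : 'I_n -> C)
    (u : 'rV[C]_r) (v : 'M[C]_r) : R :=
  \det (\matrix_(k < r, j < r) darg lam z j u (row k v)).

End Complexified.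

(** ** The torus T *)

(** The complexification of the dual of t: the pair w stands for
    w.1 + i w.2. *)
Definition tdualC : Type := ('Hom(t, R^o) * 'Hom(t, R^o))%type.

Definition torus_rel : rel tdualC :=
  fun v w => `[< dual_lattice Gamma_t (v.1 - w.1) >] && (v.2 == w.2).

Lemma torus_rel_equiv : equiv_class_of torus_rel.
Proof.
split=> [v|v w|w v x].
- rewrite /torus_rel eqxx andbT; apply/asboolP => y _.
  by rewrite subrr zero_lfunE rpred0.
- rewrite /torus_rel [w.2 == _]eq_sym; congr (_ && _).
  by apply/asboolP/asboolP => vw y /vw; rewrite !lfunE/= !lfunE/= -rpredN opprB.
- move=> /andP[/asboolP vw /eqP vw2] /andP[/asboolP wx /eqP wx2].
  rewrite /torus_rel vw2 wx2 eqxx andbT; apply/asboolP => y Gy.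
  by rewrite -(subrKA w.1) lfunE/= rpredD ?vw ?wx.
Qed.

Canonical torus_equiv : equiv_rel tdualC := EquivRelPack torus_rel_equiv.

Definition torus := {eq_quot torus_equiv}.

Definition cexp (x : C) : C :=
  (expR (complex.Re x))%:C *
  (cos (complex.Im x) +i* sin (complex.Im x)).

Definition pairC (w : tdualC) (b : t) : C := (w.1 b : R) +i* (w.2 b : R).

Definition e_ (b : t) (w : torus) : C :=
  cexp ((pi *+ 2)%:C * 'i%C * pairC (repr w) b).

Lemma periodic_intr (f : R -> R) (T x : R) (m : int) :
  periodic f T -> f (x + T * m%:~R) = f x.
Proof.
move=> fT; case: (intP m) => [|k|k].
- by rewrite mulr0 addr0.
- by rewrite -pmulrn mulr_natr (periodicn fT).
- by rewrite mulrNz -pmulrn mulrN mulr_natr -[LHS](periodicn fT k.+1) subrK.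
Qed.

Lemma e_pi (b : t) (v : tdualC) : Gamma_t b ->
  e_ b (\pi_torus v) = cexp ((pi *+ 2)%:C * 'i%C * pairC v b).
Proof.
move=> Gb; rewrite /e_.
have : torus_rel (repr (\pi_torus v)) v by apply/eqmodP; rewrite reprK.
case/andP=> /asboolP /(_ _ Gb) + /eqP.
case: (repr _) => x y /= /intrP[m] + ->; rewrite lfunE/= lfunE/= => /eqP.
rewrite subr_eq /cexp /pairC /= => /eqP ->; simpc => /=.
by rewrite mulrDr [_ + pi *+ 2 * v.1 b]addrC !periodic_intr//;
  [exact: sinD2pi|exact: cosD2pi].
Qed.

(** ** The B-side *)
Section BSide.
Variables (h : d.-tuple 'Hom(t, R^o)) (z : 'I_n -> C).

Definition D_B (x : 'I_n -> C) : C :=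
  \det (\matrix_(j < d, k < d)
    \sum_i (tnth h j (beta i) : R)%:C * (tnth h k (beta i) : R)%:C * x i).

Definition ze (w : torus) (i : 'I_n) : C := z i * e_ (beta i) w.

Definition f_ (w : torus) : C := 1 - \sum_i ze w i.

Definition O_B : set torus :=
  [set w | forall k : 'I_d,
     \sum_i z i * (tnth h k (beta i) : R)%:C * e_ (beta i) w = 0].

Definition bracket_B (P : mpoly.mpoly n C) : C :=
  \sum_(w \in O_B) mpoly.meval (ze w) P / (f_ w * D_B (ze w)).

(** O_B regarded as a subset of U_A. *)
Definition O_B_in_U (e : r.-tuple a) : set 'rV[C]_r :=
  [set u | U_A e u /\
     exists2 w, O_B w & forall i, cform e (alpha i) u = ze w i].

End BSide.

(** The coefficient, with respect to dmu, of the integrated form. *)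
Definition integrand (e lam : r.-tuple a) (z : 'I_n -> C)
    (P : mpoly.mpoly n C) (u : 'rV[C]_r) : C :=
  mpoly.meval (fun i => cform e (alpha i) u) P * \prod_j p_ e lam j u
  / ((1 - cform e kappa u) * \prod_i cform e (alpha i) u
     * \prod_j (p_ e lam j u - q_ lam z j)).

End Sequence.

Arguments Gamma_g {R r n d} S.
Arguments Gamma_a {R r n d} S.
Arguments Gamma_t {R r n d} S.

Definition nbhd_of (R : realType) (r : nat) (A U : set 'rV[R[i]]_r) : Prop :=
  forall u, A u -> nbhs (u : 'rV[R[i]^o]_r) U.

Definition homogeneous (R : realType) (n d : nat) (P : mpoly.mpoly n R[i])
    : bool :=
  P \is mpoly.ishomog1 d (mpoly.mpoly_mdeg__canonical__mpoly_Measure n).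

(** * Integration of forms of degree r over oriented r-dimensional
      submanifolds of C^r *)

Section FormIntegral.
Variable R : realType.
Local Notation C := R[i].

Definition cube (r : nat) : set 'rV[R]_r :=
  [set s | forall j, 0 <= s 0 j <= 1].
Definition open_cube (r : nat) : set 'rV[R]_r :=
  [set s | forall j, 0 < s 0 j < 1].

(** The iterated integral over [0, 1]^r. *)
Fixpoint cube_Rintegral (r : nat) : ('rV[R]_r -> R) -> R :=
  match r with
  | 0 => fun F => F 0
  | r'.+1 => fun F =>
      (\int[lebesgue_measure]_(x in `[0%R, 1%R])
         cube_Rintegral (fun s : 'rV[R]_r' => F (row_mx (\row_(_ < 1) x) s)))%R
  end.

Definition cube_integral (r : nat) (F : 'rV[R]_r -> C) : C :=
  cube_Rintegral (fun s => complex.Re (F s))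
  +i* cube_Rintegral (fun s => complex.Im (F s)).

Section Patch.
Variables (r : nat) (phi : 'rV[R]_r -> 'rV[C]_r).

Definition re_part (j : 'I_r) (s : 'rV[R]_r) : R := complex.Re (phi s 0 j).
Definition im_part (j : 'I_r) (s : 'rV[R]_r) : R := complex.Im (phi s 0 j).

Definition C1_at (F : 'rV[R]_r -> R) (s : 'rV[R]_r) : Prop :=
  differentiable F s /\
  forall k, {for s, continuous (fun x => 'D_(delta_mx 0 k) F x)}.

(** phi is of class C^1 on a neighborhood of the closed cube. *)
Definition C1_patch : Prop :=
  forall s, cube s -> \forall x \near s,
    forall j, C1_at (re_part j) x /\ C1_at (im_part j) x.

(** The k-th row is the partial derivative of phi in the k-th direction. *)
Definition tangent (s : 'rV[R]_r) : 'M[C]_r :=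
  \matrix_(k, j) ('D_(delta_mx 0 k) (re_part j) s
                  +i* 'D_(delta_mx 0 k) (im_part j) s).

End Patch.

(** The phi_k are patches which cover M, do not overlap outside of the
    boundaries of the cubes, and are positive for the orientation form tau.
    A form of degree r is a function of a point and of the matrix whose rows
    are the r tangent vectors. *)
Definition oriented_tiling (r : nat) (M : set 'rV[C]_r)
    (tau : 'rV[C]_r -> 'M[C]_r -> R)
    (m : nat) (phi : 'I_m -> 'rV[R]_r -> 'rV[C]_r) : Prop :=
  [/\ forall k, C1_patch (phi k),
      M = \bigcup_k phi k @` @cube r,
      forall k l s x, open_cube s -> open_cube x -> phi k s = phi l x ->
        k = l /\ s = x
    & forall k s, open_cube s -> 0 < tau (phi k s) (tangent (phi k) s)].

(** I is the integral of the form eta over M, oriented by tau. *)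
Definition is_form_integral (r : nat) (M : set 'rV[C]_r)
    (tau : 'rV[C]_r -> 'M[C]_r -> R) (eta : 'rV[C]_r -> 'M[C]_r -> C)
    (I : C) : Prop :=
  exists m (phi : 'I_m -> 'rV[R]_r -> 'rV[C]_r),
    oriented_tiling M tau phi /\
    I = \sum_k cube_integral (fun s => eta (phi k s) (tangent (phi k) s)).

End FormIntegral.

(* Main.v *)
From HB Require Import structures.
Require Import Defs.
From mathcomp Require Import all_boot all_order all_algebra.
From mathcomp Require Import all_classical all_reals all_analysis.
From mathcomp Require Import ring lra zify.
From mathcomp Require mpoly.

Set Implicit Arguments.
Unset Strict Implicit.
Unset Printing Implicit Defensive.

Import Order.TTheory GRing.Theory Num.Theory numFieldNormedType.Exports.

Local Open Scope classical_set_scope.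
Local Open Scope ring_scope.
Local Open Scope complex_scope.

(** The integral is a sum of Grothendieck residues, one for each point of [O_B].
    The points of [O_B] correspond to points [u_k] of [U_A] where the map
    [p = (p_1, ..., p_r)] takes the value [q] ([O_B_point], [ze_inj], [p_q]), and
    there the Jacobian of [p] does not vanish.  Near [u_k] the map [p] has a
    holomorphic inverse [g_k] ([local_chart]), and for small [delta] the part of
    the cycle near [u_k] is the image under [g_k] of the torus
    [|w_j - q_j| = delta].  Parametrizing this torus by angles, the integrand
    becomes a holomorphic function of [w] in which the denominators
    [p_j - q_j] have been cancelled by the velocities and the inverse Jacobian of
    [p] has appeared ([torus_patch_integrand]).  By the mean value property on
    polydiscs ([mean_value_torus]) its integral is [(2 pi i)^r] times the value of
    [P(alpha) \prod p_j / ((1 - kappa) \prod alpha_i  det (d p))] at [u_k].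

    The last step is an identity between determinants ([D_B_gale]): after the
    factor [\prod p_j] is taken out of [det (d p)], what remains times
    [\prod alpha_i] is [D_B (alpha)].  In coordinates the maps of the exact
    sequence are two integer matrices [E] and [H] whose rows span orthogonal
    saturated lattices, and for a diagonal matrix [X] one has
    [det X det (E X^-1 E^T) = det (H X H^T)], because both determinants are
    complementary minors of mutually inverse matrices once [E] and [H] are
    completed to one unimodular matrix and its inverse ([gale_det]).  This uses
    that the bases are bases over the integers; the orientation of [lam] fixes
    the sign.

    The analysis rests on strict derivatives ([sderiv]).  They are preserved by
    algebraic operations, compositions and local inverses, and they yield the
    real C^1 regularity of the patches.  The inverse function theorem comes from
    a contraction ([local_inverse]), and the one-variable mean value property
    from differentiation under the integral sign ([mean_value_circle]).

    For the neighborhood [U0] one takes small balls around the [u_k] on which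
    [p] is injective.  Injectivity, in the quantitative form
    [c |x - y| <= |p x - p y|], shows that within [U0] the level set
    [|p_j - q_j| = delta] lies close to the [u_k], hence inside any given
    smaller neighborhood [U] once [delta] is small. *)

(** * Real-valued norms *)

Section Norms.
Variable R : realType.

(** Real, complex and row-vector arguments occur together, with norms that take
    values in different fields; this record gives them all one real-valued
    norm, so that a single notion of derivative serves throughout. *)
Record seminorm (V : zmodType) := Seminorm {
  snorm :> V -> R;
  snormD : forall x y, snorm (x + y) <= snorm x + snorm y;
  snormN : forall x, snorm (- x) = snorm x;
  snorm0 : snorm 0 = 0 }.

Lemma snorm_ge0 (V : zmodType) (N : seminorm V) x : 0 <= N x.
Proof.
have := snormD N x (- x); rewrite subrr snorm0 snormN -mulr2n.
by rewrite pmulrn_lge0.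
Qed.

Lemma snormB (V : zmodType) (N : seminorm V) x y : N (x - y) <= N x + N y.
Proof. by rewrite (le_trans (snormD _ _ _))// snormN. Qed.

Lemma snorm_tri (V : zmodType) (N : seminorm V) x y z :
  N (x - z) <= N (x - y) + N (y - z).
Proof. by rewrite (le_trans _ (snormD _ _ _))// subrKA. Qed.

Definition cabs (x : R[i]) : R := complex.Re `|x|.

Lemma cabsE (x : R[i]) : (cabs x)%:C = `|x|.
Proof. by rewrite /cabs normc_def. Qed.

Lemma cabs_real (x : R) : cabs x%:C = `|x|.
Proof. by rewrite /cabs normc_def/= expr0n/= addr0 sqrtr_sqr. Qed.

Lemma cabsM x y : cabs (x * y) = cabs x * cabs y.
Proof. by apply: complexI; rewrite rmorphM/= !cabsE normrM. Qed.

Lemma cabsV x : cabs x^-1 = (cabs x)^-1.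
Proof. by apply: complexI; rewrite cabsE normfV fmorphV/= cabsE. Qed.

Lemma cabsD x y : cabs (x + y) <= cabs x + cabs y.
Proof. by rewrite -lecR rmorphD/= !cabsE ler_normD. Qed.

Lemma cabsN x : cabs (- x) = cabs x.
Proof. by rewrite /cabs normrN. Qed.

Lemma cabs0 : cabs 0 = 0.
Proof. by rewrite /cabs normr0. Qed.

Lemma cabs_eq0 x : (cabs x == 0) = (x == 0).
Proof. by rewrite -(inj_eq (@complexI _)) cabsE normr_eq0. Qed.

Lemma cabs_gt0 x : (0 < cabs x) = (x != 0).
Proof. by rewrite -ltcR cabsE normr_gt0. Qed.

Definition cabs_norm := Seminorm cabsD cabsN cabs0.

Lemma cabs_ge0 x : 0 <= cabs x.
Proof. exact: (snorm_ge0 cabs_norm). Qed.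

Lemma Re_le_cabs x : `|complex.Re x| <= cabs x.
Proof.
case: x => a b; rewrite /cabs normc_def/= -sqrtr_sqr ler_wsqrtr//.
by rewrite lerDl sqr_ge0.
Qed.

Lemma Im_le_cabs x : `|complex.Im x| <= cabs x.
Proof.
case: x => a b; rewrite /cabs normc_def/= -sqrtr_sqr ler_wsqrtr//.
by rewrite lerDr sqr_ge0.
Qed.

Lemma cabs_i : cabs 'i%C = 1.
Proof. by rewrite /cabs normc_def/= expr0n/= expr1n add0r sqrtr1. Qed.

Lemma cabs_le_ReIm x : cabs x <= `|complex.Re x| + `|complex.Im x|.
Proof.
case: x => a b; have -> : a +i* b = a%:C + 'i%C * b%:C by simpc.
rewrite (le_trans (cabsD _ _))// cabsM !cabs_real cabs_i mul1r/=.
by rewrite !mul0r !mul1r subr0 addr0 !add0r.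
Qed.

Lemma Re_scale (z : R[i]) (k : R) : complex.Re (k%:C * z) = k * complex.Re z.
Proof. by case: z => ? ? /=; rewrite mul0r subr0. Qed.

Lemma Im_scale (z : R[i]) (k : R) : complex.Im (k%:C * z) = k * complex.Im z.
Proof. by case: z => ? ? /=; rewrite mul0r addr0. Qed.

Section RowNorm.
Variable r : nat.
Implicit Types u v : 'rV[R[i]]_r.

Definition cnorm u : R := \big[Num.max/0]_j cabs (u 0 j).

Lemma cnorm_leP u (c : R) : 0 <= c ->
  reflect (forall j, cabs (u 0 j) <= c) (cnorm u <= c).
Proof.
move=> c0; apply: (iffP (bigmax_leP _ _ _ _)) => [[_ H] j|H]; first exact: H.
by split.
Qed.

Lemma cnorm_ltP u (c : R) : 0 < c ->
  reflect (forall j, cabs (u 0 j) < c) (cnorm u < c).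
Proof.
move=> c0; apply: (iffP (bigmax_ltP _ _ _ _)) => [[_ H] j|H]; first exact: H.
by split.
Qed.

Lemma cnorm_coord u j : cabs (u 0 j) <= cnorm u.
Proof. exact: (@le_bigmax _ _ _ 0 (fun j => cabs (u 0 j))). Qed.

Lemma cnorm_ge0 u : 0 <= cnorm u.
Proof. by rewrite /cnorm; elim/big_ind : _ => // [x y x0 y0|j _];
  [rewrite le_max x0|exact: cabs_ge0]. Qed.

Lemma cnormD u v : cnorm (u + v) <= cnorm u + cnorm v.
Proof.
apply/cnorm_leP => [|j]; first by rewrite addr_ge0 ?cnorm_ge0.
by rewrite mxE (le_trans (cabsD _ _))// lerD ?cnorm_coord.
Qed.

Lemma cnormN u : cnorm (- u) = cnorm u.
Proof. by apply: eq_bigr => j _; rewrite mxE cabsN. Qed.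

Lemma cnorm0 : cnorm 0 = 0.
Proof. by apply/eqP; rewrite eq_le cnorm_ge0 andbT; apply/cnorm_leP => // j;
  rewrite mxE cabs0. Qed.

Definition cnorm_norm := Seminorm cnormD cnormN cnorm0.

Lemma cnorm_eq0 u : (cnorm u == 0) = (u == 0).
Proof.
apply/eqP/eqP => [u0|->]; last exact: cnorm0.
apply/rowP => j; rewrite mxE; apply/eqP; rewrite -cabs_eq0 eq_le cabs_ge0 andbT.
by rewrite -u0 cnorm_coord.
Qed.

End RowNorm.

Lemma mulmx_bounded r m (J : 'M[R[i]]_(r, m)) :
  exists2 K : R, 0 < K & forall v, cnorm (v *m J) <= K * cnorm v.
Proof.
exists (1 + \sum_i \sum_j cabs (J i j)) => [|v].
  by rewrite ltr_pwDl// sumr_ge0// => i _; rewrite sumr_ge0// => j _;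
    rewrite cabs_ge0.
have S0 : 0 <= 1 + \sum_i \sum_j cabs (J i j).
  by rewrite addr_ge0// sumr_ge0// => i _; rewrite sumr_ge0// => j _;
    rewrite cabs_ge0.
apply/cnorm_leP => [|k]; first by rewrite mulr_ge0 ?cnorm_ge0.
rewrite mxE mulrDl mul1r.
have -> : cabs (\sum_j v 0 j * J j k) = cabs_norm (\sum_j v 0 j * J j k) by [].
apply: (@le_trans _ _ (\sum_j cabs (v 0 j * J j k))).
  elim/big_ind2 : _ => // [|x1 x2 y1 y2 H1 H2]; first by rewrite snorm0.
  by rewrite (le_trans (snormD _ _ _))// lerD.
rewrite (@le_trans _ _ ((\sum_i \sum_j cabs (J i j)) * cnorm v))//; last first.
  by rewrite lerDr cnorm_ge0.
rewrite mulr_suml ler_sum// => i _; rewrite cabsM mulrC.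
rewrite ler_pM ?cabs_ge0 ?cnorm_coord//.
by rewrite (bigD1 k)//= lerDl sumr_ge0// => j _; rewrite cabs_ge0.
Qed.

Definition nmod_norm (V : normedModType R) : seminorm V :=
  Seminorm (@ler_normD R V) (@normrN R V) (@normr0 R V).

End Norms.

(** * Strict derivatives *)

Section StrictDerivative.
Variable R : realType.
Local Notation C := R[i].

(** Additivity rather than linearity: the same derivatives are used over the
    reals and over the complex numbers. *)
Definition bounded_additive (V W : zmodType) (N : seminorm R V)
    (M : seminorm R W) (L : V -> W) : Prop :=
  (forall x y, L (x - y) = L x - L y) /\
  exists2 K : R, 0 < K & forall v, M (L v) <= K * N v.

(** Strict differentiability at [a]: the increments between any two points near
    [a] are compared, not only those from [a].  It is stable under all algebraic
    operations and compositions, and makes a map with invertible derivative a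
    Lipschitz perturbation of a linear isomorphism.  When it holds at all points
    near [a] it makes the derivative continuous at [a], so it replaces being of
    class C^1. *)
Definition sderiv (V W : zmodType) (N : seminorm R V) (M : seminorm R W)
    (f : V -> W) (a : V) (L : V -> W) : Prop :=
  bounded_additive N M L /\
  forall eps : R, 0 < eps -> exists2 del : R, 0 < del &
    forall x y, N (x - a) < del -> N (y - a) < del ->
      M (f x - f y - L (x - y)) <= eps * N (x - y).

Section General.
Variables (V W : zmodType) (NV : seminorm R V) (NW : seminorm R W).

Lemma bounded_additive0 (L : V -> W) : bounded_additive NV NW L -> L 0 = 0.
Proof. by case=> HL _; rewrite -(subrr 0) HL subrr. Qed.

Lemma bounded_additiveN (L : V -> W) x : bounded_additive NV NW L -> L (- x) = - L x.
Proof. by move=> HL; rewrite -sub0r HL.1 bounded_additive0// sub0r. Qed.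

Lemma bounded_additiveD (L : V -> W) x y : bounded_additive NV NW L -> L (x + y) = L x + L y.
Proof. by move=> HL; rewrite -{1}(opprK y) HL.1 bounded_additiveN// opprK. Qed.

(** A strict derivative gives a Lipschitz bound near the point: the linear part
    is bounded and the remainder is at most the increment. *)
Lemma sderiv_lip (f : V -> W) a L : sderiv NV NW f a L ->
  exists2 K : R, 0 < K & exists2 del : R, 0 < del &
    forall x y, NV (x - a) < del -> NV (y - a) < del ->
      NW (f x - f y) <= K * NV (x - y).
Proof.
move=> [[HL [K K0 HK]] /(_ 1 ltr01)[del del0 H]]; exists (1 + K).
  by rewrite addr_gt0.
exists del => // x y xa ya; rewrite -(subrK (L (x - y)) (f x - f y)).
by rewrite (le_trans (snormD _ _ _))// mulrDl lerD// H.
Qed.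

Lemma sderiv_continuous (f : V -> W) a L : sderiv NV NW f a L ->
  forall eps : R, 0 < eps -> exists2 del : R, 0 < del &
    forall x, NV (x - a) < del -> NW (f x - f a) < eps.
Proof.
move=> /sderiv_lip[K K0 [del del0 H]] eps eps0.
exists (Num.min del (eps / K)) => [|x]; first by rewrite lt_min del0 divr_gt0.
rewrite lt_min => /andP[xd xe]; rewrite (le_lt_trans (H _ _ xd _))//.
  by rewrite subrr snorm0.
by rewrite mulrC -ltr_pdivlMr.
Qed.

Lemma sderiv_ext (f g : V -> W) a L M : f =1 g -> L =1 M ->
  sderiv NV NW f a L -> sderiv NV NW g a M.
Proof. by move=> /funext -> /funext ->. Qed.

Lemma sderiv_lin (L : V -> W) a : bounded_additive NV NW L ->
  sderiv NV NW L a L.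
Proof.
move=> HL; split=> // eps eps0; exists 1 => // x y _ _.
by rewrite HL.1 subrr snorm0 mulr_ge0 ?snorm_ge0 ?ltW.
Qed.

Lemma sderiv_cst (c : W) a : sderiv NV NW (fun=> c) a (fun=> 0).
Proof.
split=> [|eps eps0].
  split=> [x y|]; first by rewrite subrr.
  by exists 1 => // v; rewrite snorm0 mul1r snorm_ge0.
exists 1 => // x y _ _.
by rewrite !subrr snorm0 mulr_ge0 ?snorm_ge0 ?ltW.
Qed.

Lemma sderivD (f g : V -> W) a L M :
  sderiv NV NW f a L -> sderiv NV NW g a M ->
  sderiv NV NW (fun x => f x + g x) a (fun v => L v + M v).
Proof.
move=> [[HL [K K0 HK]] Hf] [[HM [J J0 HJ]] Hg]; split=> [|eps eps0].
  split=> [x y|]; first by rewrite HL HM addrACA opprD.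
  exists (K + J) => [|v]; first by rewrite addr_gt0.
  by rewrite mulrDl (le_trans (snormD _ _ _))// lerD.
have e2 : 0 < eps / 2 by rewrite divr_gt0.
have [d1 d10 H1] := Hf _ e2; have [d2 d20 H2] := Hg _ e2.
exists (Num.min d1 d2) => [|x y]; first by rewrite lt_min d10.
rewrite !lt_min => /andP[x1 x2] /andP[y1 y2].
have -> : f x + g x - (f y + g y) - (L (x - y) + M (x - y)) =
  (f x - f y - L (x - y)) + (g x - g y - M (x - y)).
  by rewrite !opprD (addrACA (f x)) [LHS]addrACA.
rewrite (le_trans (snormD _ _ _))// (splitr eps) mulrDl lerD//.
  exact: H1.
exact: H2.
Qed.

End General.

Lemma sderiv_comp (U V W : zmodType) (NU : seminorm R U) (NV : seminorm R V)
    (NW : seminorm R W) (f : U -> V) (g : V -> W) a L M :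
  sderiv NU NV f a L -> sderiv NV NW g (f a) M ->
  sderiv NU NW (g \o f) a (M \o L).
Proof.
move=> Hf Hg; have [K K0 [d0 d00 HfK]] := sderiv_lip Hf.
move: Hf Hg => [[HL [KL KL0 HKL]] Hf] [[HM [KM KM0 HKM]] Hg].
split=> [|eps eps0].
  split=> [x y|]; first by rewrite /= HL HM.
  exists (KM * KL) => [|v]; first by rewrite mulr_gt0.
  by rewrite /= -mulrA (le_trans (HKM _))// ler_wpM2l// ltW.
have e1 : 0 < eps / (2 * KM) by rewrite divr_gt0// mulr_gt0.
have e2 : 0 < eps / (2 * K) by rewrite divr_gt0// mulr_gt0.
have [d1 d10 H1] := Hf _ e1; have [d2 d20 H2] := Hg _ e2.
exists (Num.min d0 (Num.min d1 (d2 / K))) => [|x y].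
  by rewrite !lt_min d00 d10 divr_gt0.
rewrite !lt_min => /and3P[x0 x1 x2] /and3P[y0 y1 y2] /=.
have fnear t : NU (t - a) < d0 -> NU (t - a) < d2 / K -> NV (f t - f a) < d2.
  move=> t0 t2; rewrite (le_lt_trans (HfK _ _ t0 _)) ?subrr ?snorm0//.
  by rewrite mulrC -ltr_pdivlMr.
rewrite -(subrK (M (f x - f y)) (_ - g (f y))) -addrA -HM.
rewrite (le_trans (snormD _ _ _))// (splitr eps) mulrDl lerD//.
  rewrite (le_trans (H2 _ _ (fnear _ x0 x2) (fnear _ y0 y2)))//.
  rewrite (le_trans (ler_wpM2l (ltW e2) (HfK _ _ x0 y0)))//.
  by rewrite mulrA ler_wpM2r ?snorm_ge0// invfM mulrA divfK ?gt_eqF.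
rewrite (le_trans (HKM _))// (le_trans (ler_wpM2l (ltW KM0) (H1 _ _ x1 y1)))//.
rewrite mulrA ler_wpM2r ?snorm_ge0//.
by have -> : KM * (eps / (2 * KM)) = eps / 2 by field; rewrite gt_eqF.
Qed.

Section ComplexValued.
Variables (V : zmodType) (NV : seminorm R V).
Local Notation NC := (cabs_norm R).
Implicit Types f g : V -> C.

Lemma sderivM f g a L M : sderiv NV NC f a L -> sderiv NV NC g a M ->
  sderiv NV NC (fun x => f x * g x) a (fun v => L v * g a + f a * M v).
Proof.
move=> Hf Hg.
have [Kf Kf0 [d0 d00 HfK]] := sderiv_lip Hf.
have [Kg Kg0 [d0' d00' HgK]] := sderiv_lip Hg.
have cf := sderiv_continuous Hf; have cg := sderiv_continuous Hg.
move: Hf Hg => [[HL [KL KL0 HKL]] Hf] [[HM [KM KM0 HKM]] Hg].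
split=> [|eps eps0].
  split=> [x y|]; first by rewrite HL HM; ring.
  exists (1 + (KL * cabs (g a) + cabs (f a) * KM)) => [|v].
    by rewrite ltr_pwDl// addr_ge0// mulr_ge0 ?cabs_ge0 ?ltW.
  rewrite mulrDl mul1r /= (le_trans (cabsD _ _))//.
  rewrite (@le_trans _ _ ((KL * cabs (g a) + cabs (f a) * KM) * NV v))//;
    last by rewrite lerDr snorm_ge0.
  rewrite mulrDl !cabsM lerD//.
    by rewrite [leRHS]mulrAC ler_wpM2r ?cabs_ge0// HKL.
  by rewrite -mulrA ler_wpM2l ?cabs_ge0// HKM.
(* With L and M taken at x - y, the remainder of the product is
   (f x - f y - L) g(x) + L (g x - g a) + f(y) (g x - g y - M) + (f y - f a) M,
   and each of the four terms is made at most a quarter of the error. *)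
set ga := 1 + cabs (g a); set fa := 1 + cabs (f a).
have ga0 : 0 < ga by rewrite ltr_pwDl ?cabs_ge0.
have fa0 : 0 < fa by rewrite ltr_pwDl ?cabs_ge0.
have e4 : 0 < eps / 4 by rewrite divr_gt0.
have [d1 d10 H1] := Hf _ (divr_gt0 e4 ga0).
have [d2 d20 H2] := Hg _ (divr_gt0 e4 fa0).
have [d3 d30 H3] := cg _ (divr_gt0 e4 KL0).
have [d4 d40 H4] := cf _ (divr_gt0 e4 KM0).
have [d5 d50 H5] := cg _ ltr01.
have [d6 d60 H6] := cf _ ltr01.
pose d := Num.min d1 (Num.min d2 (Num.min d3 (Num.min d4 (Num.min d5 d6)))).
exists d => [|x y]; first by rewrite !lt_min d10 d20 d30 d40 d50 d60.
rewrite /d !lt_min => /and5P[x1 x2 x3 x4 /andP[x5 x6]].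
move=> /and5P[y1 y2 y3 y4 /andP[y5 y6]].
have -> : f x * g x - f y * g y - (L (x - y) * g a + f a * M (x - y)) =
  ((f x - f y - L (x - y)) * g x + L (x - y) * (g x - g a)) +
  (f y * (g x - g y - M (x - y)) + (f y - f a) * M (x - y)) by ring.
have gx : cabs (g x) <= ga.
  rewrite -(subrK (g a) (g x)) (le_trans (cabsD _ _))// lerD2r.
  exact/ltW/H5.
have fy : cabs (f y) <= fa.
  rewrite -(subrK (f a) (f y)) (le_trans (cabsD _ _))// lerD2r.
  exact/ltW/H6.
have N0 := snorm_ge0 NV (x - y).
have -> : eps * NV (x - y) = (eps / 4 * NV (x - y) + eps / 4 * NV (x - y)) +
  (eps / 4 * NV (x - y) + eps / 4 * NV (x - y)) by field.
rewrite /= (le_trans (cabsD _ _))// lerD//.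
  rewrite (le_trans (cabsD _ _))// !cabsM lerD//.
    rewrite (@le_trans _ _ (eps / 4 / ga * NV (x - y) * ga))//.
      by rewrite ler_pM ?cabs_ge0// H1.
    by rewrite mulrAC divfK ?gt_eqF.
  rewrite (@le_trans _ _ (KL * NV (x - y) * (eps / 4 / KL)))//.
    by rewrite ler_pM ?cabs_ge0// ?HKL// ltW// H3.
  by rewrite mulrAC [KL * _]mulrC divfK ?gt_eqF.
rewrite (le_trans (cabsD _ _))// !cabsM lerD//.
  rewrite (@le_trans _ _ (fa * (eps / 4 / fa * NV (x - y))))//.
    by rewrite ler_pM ?cabs_ge0// H2.
  by rewrite mulrA [fa * _]mulrC divfK ?gt_eqF.
rewrite (@le_trans _ _ ((eps / 4 / KM) * (KM * NV (x - y))))//.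
  by rewrite ler_pM ?cabs_ge0// ?HKM// ltW// H4.
by rewrite mulrA divfK ?gt_eqF.
Qed.

Lemma inv_sderiv (b : C) : b != 0 ->
  sderiv NC NC (fun x => x^-1) b (fun v => - v / b ^+ 2).
Proof.
move=> b0; have cb : 0 < cabs b by rewrite cabs_gt0.
split=> [|eps eps0].
  split=> [x y|]; first by field.
  exists (cabs b ^- 2) => [|v]; first by rewrite invr_gt0 exprn_gt0.
  by rewrite /= cabsM cabsN expr2 cabsV cabsM mulrC.
(* The remainder 1/x - 1/y + (x - y)/b^2 is (x - y)(x y - b^2)/(x y b^2).  If x
   and y are within D of b, where D is at most |b|/2, then the quotient
   (x y - b^2)/(x y b^2) is at most 6 D/|b|^3, so 10 leaves room. *)
pose K := 10 * cabs b ^- 3.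
have K0 : 0 < K by rewrite mulr_gt0 ?invr_gt0 ?exprn_gt0.
exists (Num.min (cabs b / 2) (eps / K)) => [|x y].
  by rewrite lt_min (divr_gt0 eps0 K0) (divr_gt0 cb)//.
rewrite !lt_min => /andP[x1 x2] /andP[y1 y2]; rewrite /= in x1 x2 y1 y2 *.
have lb t : cabs (t - b) < cabs b / 2 -> cabs b / 2 <= cabs t.
  move=> tb; have : cabs b <= cabs t + cabs (t - b).
    by rewrite -[in X in X <= _](subKr t b) (le_trans (cabsD _ _))// cabsN.
  by move: tb; lra.
have lx := lb _ x1; have ly := lb _ y1.
have cx : 0 < cabs x by rewrite (lt_le_trans _ lx)// divr_gt0.
have cy : 0 < cabs y by rewrite (lt_le_trans _ ly)// divr_gt0.
have x0 : x != 0 by rewrite -cabs_gt0.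
have y0 : y != 0 by rewrite -cabs_gt0.
have -> : x^-1 - y^-1 - - (x - y) / b ^+ 2 =
  (x - y) * ((x - b) / x + (y - b) * b / (x * y)) / b ^+ 2.
  by field; rewrite x0 y0 b0.
rewrite expr2 !cabsM cabsV cabsM -mulrA mulrC ler_wpM2r ?cabs_ge0//.
have uxi : (cabs x)^-1 <= 2 / cabs b.
  by rewrite -[leRHS]invrK lef_pV2 ?posrE ?invr_gt0 ?divr_gt0// invfM invrK mulrC.
have uyi : (cabs y)^-1 <= 2 / cabs b.
  by rewrite -[leRHS]invrK lef_pV2 ?posrE ?invr_gt0 ?divr_gt0// invfM invrK mulrC.
have A : cabs ((x - b) / x + (y - b) * b / (x * y)) <= eps / K * (6 / cabs b).
  rewrite (le_trans (cabsD _ _))//.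
  have -> : eps / K * (6 / cabs b) = eps / K * (2 / cabs b) +
     eps / K * cabs b * ((2 / cabs b) * (2 / cabs b)) by field; rewrite !gt_eqF.
  rewrite !cabsM !cabsV cabsM invfM lerD//.
    by rewrite ler_pM ?cabs_ge0 ?invr_ge0 ?cabs_ge0// ltW.
  rewrite ler_pM ?mulr_ge0 ?invr_ge0 ?cabs_ge0//.
    by rewrite ler_wpM2r ?cabs_ge0// ltW.
  by rewrite ler_pM ?invr_ge0 ?cabs_ge0.
rewrite (le_trans (ler_wpM2r _ A))//.
  by rewrite invr_ge0 mulr_ge0 ?cabs_ge0.
rewrite [leLHS](_ : _ = eps * (6 / 10)).
  by rewrite ler_piMr ?ltW//; lra.
by rewrite /K; field; rewrite gt_eqF.
Qed.

Lemma sderivV f a L : f a != 0 -> sderiv NV NC f a L ->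
  sderiv NV NC (fun x => (f x)^-1) a (fun v => - L v / f a ^+ 2).
Proof.
by move=> fa0 Hf; exact: (sderiv_comp Hf (inv_sderiv fa0)).
Qed.

End ComplexValued.

(** The constants of finitely many coordinates are combined by a sum for the
    bound and by a minimum for the radius. *)
Lemma sderiv_row (V : zmodType) (NV : seminorm R V) m (f : V -> 'rV[C]_m) a
    (L : V -> 'rV[C]_m) :
  (forall j, sderiv NV (cabs_norm R) (fun x => f x 0 j) a (fun v => L v 0 j)) ->
  sderiv NV (cnorm_norm R m) f a L.
Proof.
move=> Hf; split.
  split=> [x y|].
    by apply/rowP => j; have [[-> _] _] := Hf j; rewrite !mxE.
  have : forall j, exists K : R, 0 < K /\ forall v, cabs (L v 0 j) <= K * NV v.
    by move=> j; have [[_ [K K0 HK]] _] := Hf j; exists K.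
  move=> /choice[K HK].
  have K0 : 0 <= \sum_j K j by rewrite sumr_ge0// => j _; rewrite ltW// (HK j).1.
  exists (1 + \sum_j K j) => [|v]; first by rewrite ltr_pwDl.
  apply/cnorm_leP => [|j]; first by rewrite mulr_ge0 ?snorm_ge0// addr_ge0.
  rewrite (le_trans ((HK j).2 v))// ler_wpM2r ?snorm_ge0//.
  by rewrite (bigD1 j)//= addrCA lerDl addr_ge0// sumr_ge0// => k _;
    rewrite ltW// (HK k).1.
move=> eps eps0.
have : forall j, exists d : R, 0 < d /\ forall x y, NV (x - a) < d ->
    NV (y - a) < d -> cabs (f x 0 j - f y 0 j - L (x - y) 0 j)
      <= eps * NV (x - y).
  by move=> j; have [_ /(_ _ eps0)[d d0 H]] := Hf j; exists d.
move=> /choice[d Hd]; exists (\big[Num.min/1]_j d j) => [|x y xa ya].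
  by apply/bigmin_gtP; split=> // j _; exact: (Hd j).1.
apply/cnorm_leP => [|j]; first by rewrite mulr_ge0 ?snorm_ge0// ltW.
rewrite !mxE; apply: (Hd j).2.
  by rewrite (lt_le_trans xa)// bigmin_le.
by rewrite (lt_le_trans ya)// bigmin_le.
Qed.

(** Strict differentiability at [a] makes nearby derivatives close to the one at
    [a]: both approximate the same increments between points near [a].  Only
    small vectors are compared, since additivity alone does not extend the bound
    to the others. *)
Lemma sderiv_uniq_near (V W : zmodType) (NV : seminorm R V)
    (NW : seminorm R W) (f : V -> W) a (L : V -> W) (L_ : V -> V -> W)
    (del0 : R) (eps : R) :
  sderiv NV NW f a L -> 0 < del0 ->
  (forall x, NV (x - a) < del0 -> sderiv NV NW f x (L_ x)) -> 0 < eps ->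
  exists2 del : R, 0 < del & forall x, NV (x - a) < del ->
    exists2 eta : R, 0 < eta & forall v, NV v < eta ->
      NW (L_ x v - L v) <= eps * NV v.
Proof.
move=> [HL Hf] del00 HL_ eps0.
have e2 : 0 < eps / 2 by rewrite divr_gt0.
have [d1 d10 H1] := Hf _ e2.
exists (Num.min del0 d1) => [|x]; first by rewrite lt_min del00.
rewrite lt_min => /andP[xd x1]; have [_ /(_ _ e2)[d2 d20 H2]] := HL_ x xd.
exists (Num.min d2 (d1 - NV (x - a))) => [|v].
  by rewrite lt_min d20 subr_gt0.
rewrite lt_min => /andP[v2 v1].
have xvx : x + v - x = v by rewrite addrC addKr.
have -> : L_ x v - L v =
   (f (x + v) - f x - L (x + v - x)) - (f (x + v) - f x - L_ x (x + v - x)).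
  by rewrite xvx opprB [RHS]addrC subrKA.
rewrite (le_trans (snormB _ _ _))// (splitr eps) mulrDl.
have xvd : NV (x + v - a) < d1.
  by rewrite addrAC (le_lt_trans (snormD _ _ _))// -ltrBrDl.
have xv2 : NV (x + v - x) < d2 by rewrite xvx.
have xx2 : NV (x - x) < d2 by rewrite subrr snorm0.
have h1 := H1 _ _ xvd x1; have h2 := H2 _ _ xv2 xx2.
by rewrite lerD//; [move: h1|move: h2]; rewrite {2}xvx.
Qed.

End StrictDerivative.

(** * The inverse function theorem *)

Section InverseFunction.
Variable R : realType.
Local Notation C := R[i].

Lemma le0_geometric (x c : R) : (forall k, x <= c / 2 ^+ k) -> x <= 0.
Proof.
move=> H; rewrite leNgt; apply/negP => x0.
have c0 : 0 <= c by have := H 0; rewrite expr0 divr1 => /(le_trans (ltW x0)).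
have cx : 0 <= c / x by rewrite divr_ge0// ltW.
have := archi_boundP cx; set k := Num.bound _ => ck.
have := H k; rewrite ler_pdivlMr ?exprn_gt0// leNgt => /negP; apply.
rewrite mulrC -ltr_pdivrMr// (lt_trans ck)// -natrX ltr_nat ltn_expl//.
Qed.

(** The sequences [s k - 2 D / 2^k] and [s k + 2 D / 2^k] are monotone in opposite
    directions, so the supremum of the first lies below the second. *)
Lemma geometric_cauchy (s : nat -> R) (D : R) :
  (forall k, `|s k.+1 - s k| <= D / 2 ^+ k) ->
  exists l, forall k, `|s k - l| <= 2 * D / 2 ^+ k.
Proof.
move=> H.
have D0 : 0 <= D by have := H 0; rewrite expr0 divr1; apply: le_trans.
pose a k := s k - 2 * D / 2 ^+ k; pose b k := s k + 2 * D / 2 ^+ k.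
have half k : 2 * D / 2 ^+ k = D / 2 ^+ k + 2 * D / 2 ^+ k.+1.
  by rewrite exprS; field.
have a_homo : {homo a : k m / (k <= m)%N >-> k <= m}.
  apply: (@homo_leq _ a (fun x y => x <= y)) => // [? ? ?|k].
    exact: le_trans.
  have := H k; rewrite ler_norml /a (half k) => /andP[+ _]; lra.
have b_homo : {homo b : k m / (k <= m)%N >-> m <= k}.
  apply: (@homo_leq _ b (fun x y => y <= x)) => // [y x z xy yz|k].
    exact: le_trans yz xy.
  have := H k; rewrite ler_norml /b (half k) => /andP[_]; lra.
have ab k m : a k <= b m.
  rewrite (le_trans (a_homo _ _ (leq_maxl k m)))//.
  rewrite (le_trans _ (b_homo _ _ (leq_maxr k m)))//.
  have : 0 <= 2 * D / 2 ^+ maxn k m by rewrite !mulr_ge0// invr_ge0 exprn_ge0.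
  by rewrite /a /b; lra.
exists (sup (range a)) => k; rewrite ler_norml; apply/andP; split.
  have : sup (range a) <= b k by apply: ge_sup; [exists (a 0), 0|move=> _ [m _ <-]].
  by rewrite /b; lra.
have : a k <= sup (range a).
  by apply: ub_le_sup; [exists (b 0) => _ [m _ <-]|exists k].
by rewrite /a; lra.
Qed.

Variable r : nat.
Local Notation N := (cnorm_norm R r).
Implicit Types (p g : 'rV[C]_r -> 'rV[C]_r) (u v w x y : 'rV[C]_r).

Lemma cnorm_geometric_cauchy (s : nat -> 'rV[C]_r) (D : R) :
  (forall k, cnorm (s k.+1 - s k) <= D / 2 ^+ k) ->
  exists l, forall k, cnorm (s k - l) <= 4 * D / 2 ^+ k.
Proof.
move=> H.
have D0 : 0 <= D.
  by have := H 0; rewrite expr0 divr1; apply: le_trans; exact: cnorm_ge0.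
have /choice[f Hf] : forall j, exists l : R,
    forall k, `|complex.Re (s k 0 j) - l| <= 2 * D / 2 ^+ k.
  move=> j; apply: geometric_cauchy => k; apply: le_trans (H k).
  apply: le_trans (cnorm_coord _ j); apply: le_trans (Re_le_cabs _).
  by rewrite !mxE; case: (s k.+1 0 j) (s k 0 j) => ? ? [].
have /choice[h Hh] : forall j, exists l : R,
    forall k, `|complex.Im (s k 0 j) - l| <= 2 * D / 2 ^+ k.
  move=> j; apply: geometric_cauchy => k; apply: le_trans (H k).
  apply: le_trans (cnorm_coord _ j); apply: le_trans (Im_le_cabs _).
  by rewrite !mxE; case: (s k.+1 0 j) (s k 0 j) => ? ? [].
exists (\row_j (f j +i* h j)) => k; apply/cnorm_leP => [|j].
  by rewrite !mulr_ge0// invr_ge0 exprn_ge0.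
rewrite !mxE (le_trans (cabs_le_ReIm _))//.
have -> : 4 * D / 2 ^+ k = 2 * D / 2 ^+ k + 2 * D / 2 ^+ k by field.
by move: (Hf j k) (Hh j k); case: (s k 0 j) => a b /= Ha Hb; rewrite lerD.
Qed.

(** Newton iteration with the fixed matrix [J^-1]: near [u0] the map
    [u |-> u - (p u - w) J^-1] contracts distances by 1/2, which gives both the
    lower bound on the increments of [p] and a solution of [p u = w]. *)
Lemma local_inverse p u0 (J : 'M[C]_r) (rho1 : R) : J \in unitmx ->
  sderiv N N p u0 (fun v => v *m J) -> 0 < rho1 ->
  exists rho c sigma : R, [/\ 0 < rho <= rho1, 0 < c, 0 < sigma,
    forall x y, cnorm (x - u0) < rho -> cnorm (y - u0) < rho ->
      c * cnorm (x - y) <= cnorm (p x - p y)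
  & forall w, cnorm (w - p u0) < sigma ->
      exists2 u, cnorm (u - u0) < rho & p u = w].
Proof.
move=> uJ [_ Hp] rho10.
have [K K0 HK] := mulmx_bounded (invmx J).
have K20 : 0 < 1 / (2 * K) by rewrite divr_gt0// mulr_gt0.
have [del del0 Hdel] := Hp _ K20.
set rho := Num.min rho1 del.
have rho0 : 0 < rho by rewrite lt_min rho10.
have contr x y : cnorm (x - u0) < rho -> cnorm (y - u0) < rho ->
    cnorm ((x - y) - (p x - p y) *m invmx J) <= cnorm (x - y) / 2.
  rewrite !lt_min => /andP[_ xd] /andP[_ yd].
  have -> : (x - y) - (p x - p y) *m invmx J =
      - ((p x - p y - (x - y) *m J) *m invmx J).
    by rewrite [in RHS]mulmxBl mulmxK// opprB.
  rewrite cnormN (le_trans (HK _))//.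
  rewrite (le_trans (ler_wpM2l (ltW K0) (Hdel _ _ xd yd)))//=.
  by rewrite mulrA le_eqVlt; apply/orP; left; apply/eqP; field; rewrite gt_eqF.
exists rho, (1 / (2 * K)), (rho / (8 * K)).
split=> //; first by rewrite rho0 ge_min lexx.
- by rewrite divr_gt0// mulr_gt0.
- move=> x y xr yr; have := contr _ _ xr yr.
  have := cnormD ((x - y) - (p x - p y) *m invmx J) ((p x - p y) *m invmx J).
  rewrite subrK => H1 H2; have H3 := HK (p x - p y).
  rewrite mulrC mul1r ler_pdivrMr ?mulr_gt0// [leRHS]mulrC -mulrA.
  by move: H1 H2 H3; lra.
move=> w wsig.
pose T u := u - (p u - w) *m invmx J.
have Tcontr x y : cnorm (x - u0) < rho -> cnorm (y - u0) < rho ->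
    cnorm (T x - T y) <= cnorm (x - y) / 2.
  move=> xr yr; rewrite (le_trans _ (contr _ _ xr yr))//.
  have -> : p x - p y = (p x - w) - (p y - w) by rewrite opprB subrKA.
  rewrite mulmxBl /T; set A := _ *m _; set B := _ *m _.
  suff -> : x - A - (y - B) = x - y - (A - B) by [].
  by rewrite !opprB addrACA [RHS]addrACA [- A + _]addrC.
(* The iterates stay within 2 D of u0 and their limit within 4 D, where D is the
   length of the first step. *)
pose s k := iter k T u0.
pose D := cnorm (T u0 - u0).
have D0 : 0 <= D by exact: cnorm_ge0.
have Drho : 4 * D < rho.
  have : D <= K * cnorm (w - p u0).
    by rewrite /D /T addrC addKr -mulNmx opprB HK.
  have : K * cnorm (w - p u0) < rho / 8.
    by rewrite mulrC -ltr_pdivlMr// -mulrA -invfM.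
  by move: rho0; lra.
have Hs k : cnorm (s k - u0) <= 2 * D * (1 - (2 ^+ k)^-1) /\
    cnorm (s k.+1 - s k) <= D / 2 ^+ k.
  have near t m : t <= 2 * D * (1 - (2 ^+ m)^-1) -> t < rho.
    move=> /le_lt_trans; apply; apply: le_lt_trans Drho.
    have : 0 <= D / 2 ^+ m by rewrite mulr_ge0// invr_ge0 exprn_ge0.
    by move: D0; lra.
  elim: k => [|k [IH1 IH2]].
    by rewrite subrr cnorm0 expr0 invr1 subrr mulr0 mulr1.
  have H1 : cnorm (s k.+1 - u0) <= 2 * D * (1 - (2 ^+ k.+1)^-1).
    rewrite (le_trans (snorm_tri N _ (s k) _))//= (le_trans (lerD IH2 IH1))//.
    by rewrite le_eqVlt; apply/orP; left; apply/eqP; rewrite exprS; field.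
  split=> //; rewrite -[s k.+2]/(T (s k.+1)) -[s k.+1 in X in _ - X]/(T (s k)).
  rewrite (le_trans (Tcontr _ _ (near _ _ H1) (near _ _ IH1)))//.
  by rewrite exprSr invfM mulrA ler_wpM2r.
have [l Hl] := cnorm_geometric_cauchy (fun k => (Hs k).2).
have lu0 : cnorm (l - u0) < rho.
  rewrite -cnormN opprB (le_lt_trans _ Drho)//.
  by have := Hl 0; rewrite expr0 divr1.
exists l => //; have : T l = l.
  apply/eqP; rewrite -subr_eq0 -cnorm_eq0 eq_le cnorm_ge0 andbT.
  apply: (@le0_geometric _ (4 * D)) => k.
  rewrite (le_trans (snorm_tri N _ (T (s k)) _))//=.
  have -> : 4 * D / 2 ^+ k = 4 * D / 2 ^+ k / 2 + 4 * D / 2 ^+ k.+1.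
    by rewrite exprS; field.
  rewrite lerD//; last exact: (Hl k.+1).
  rewrite (le_trans (Tcontr _ _ _ _))//.
    rewrite (le_lt_trans (Hs k).1)// (le_lt_trans _ Drho)//.
    have : 0 <= D / 2 ^+ k by rewrite mulr_ge0// invr_ge0 exprn_ge0.
    by move: D0; lra.
  by rewrite ler_wpM2r// -cnormN opprB.
rewrite /T => /eqP; rewrite subr_eq addrC -subr_eq subrr eq_sym => /eqP E.
apply/eqP; rewrite -subr_eq0; apply/eqP.
by rewrite -(mulmxKV uJ (p l - w)) E mul0mx.
Qed.

(** The lower bound [c |x - y| <= |p x - p y|] turns the remainder of [p] at
    [g w] into a remainder of [g] at [w], after multiplication by [J^-1]. *)
Lemma inverse_sderiv p g u0 (J : 'M[C]_r) (rho c sigma : R) w :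
  0 < c ->
  (forall x y, cnorm (x - u0) < rho -> cnorm (y - u0) < rho ->
      c * cnorm (x - y) <= cnorm (p x - p y)) ->
  (forall w, cnorm (w - p u0) < sigma -> cnorm (g w - u0) < rho /\ p (g w) = w) ->
  cnorm (w - p u0) < sigma -> J \in unitmx ->
  sderiv N N p (g w) (fun v => v *m J) ->
  sderiv N N g w (fun v => v *m invmx J).
Proof.
move=> c0 low Hg wsig uJ [_ Hp].
have [K K0 HK] := mulmx_bounded (invmx J).
split=> [|eps eps0].
  by split=> [x y|]; [rewrite mulmxBl|exists K].
have e1 : 0 < eps * c / K by rewrite divr_gt0// mulr_gt0.
have [del del0 Hdel] := Hp _ e1.
exists (Num.min (sigma - cnorm (w - p u0)) (del * c)) => [|x y].
  by rewrite lt_min subr_gt0 wsig mulr_gt0.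
have near t : cnorm (t - w) < Num.min (sigma - cnorm (w - p u0)) (del * c) ->
    cnorm (t - p u0) < sigma /\ cnorm (g t - g w) < del.
  rewrite lt_min => /andP[t1 t2].
  have ts : cnorm (t - p u0) < sigma.
    by rewrite (le_lt_trans (snorm_tri N _ w _))//= -ltrBrDr.
  split=> //; have [gt pt] := Hg _ ts; have [gw pw] := Hg _ wsig.
  rewrite -(ltr_pM2l c0) [ltRHS]mulrC (le_lt_trans (low _ _ gt gw))//.
  by rewrite pt pw.
move=> /near[xs xd] /near[ys yd].
have [gx px] := Hg _ xs; have [gy py] := Hg _ ys.
have -> : g x - g y - (x - y) *m invmx J =
    - ((p (g x) - p (g y) - (g x - g y) *m J) *m invmx J).
  by rewrite [in RHS]mulmxBl mulmxK// opprB px py.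
rewrite /= cnormN (le_trans (HK _))//.
rewrite (le_trans (ler_wpM2l (ltW K0) (Hdel _ _ xd yd)))//=.
rewrite (@le_trans _ _ (eps * (c * cnorm (g x - g y))))//.
  by rewrite le_eqVlt; apply/orP; left; apply/eqP; field; rewrite gt_eqF.
rewrite ler_wpM2l ?(ltW eps0)//.
by rewrite -[x in leRHS]px -[y in leRHS]py low.
Qed.

End InverseFunction.

(** * Strict derivatives and directional derivatives *)

Section RealCalculus.
Variable R : realType.
Local Notation C := R[i].

Definition abs_norm : seminorm R R :=
  Seminorm (@ler_normD R R) (@normrN R R) (@normr0 R R).

Section Real.
Variable V : normedModType R.
Implicit Types (F : V -> R) (L : V -> R).
Local Notation NV := (nmod_norm V).

(** Comparing with the point itself, a strict derivative is a derivative. *)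
Lemma sderiv_diff F a L : scalable (L : V -> R^o) -> sderiv NV abs_norm F a L ->
  differentiable (F : V -> R^o) a /\ forall v, 'D_v (F : V -> R^o) a = L v.
Proof.
move=> sL [hba HF]; have [aL [K K0 HK]] := hba.
have lL : linear (L : V -> R^o) by move=> k x y; rewrite (bounded_additiveD _ _ hba) sL.
pose Ll : {linear V -> R^o} := HB.pack (L : V -> R^o)
  (GRing.isLinear.Build R V R^o _ (L : V -> R^o) lL).
have cL : continuous Ll.
  move=> x; apply/(@cvgrPdist_le _ _ _ (nbhs x)) => /= eps eps0.
  near=> y; rewrite -aL (le_trans (HK _))//= mulrC -ler_pdivlMr//.
  by near: y; apply: cvgr_dist_le => //; rewrite divr_gt0.
have oL : (F : V -> R^o) \o shift a = cst (F a : R^o) + Ll +o_ 0 id.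
  apply/eqaddoP => /= eps eps0; have [del del0 Hdel] := HF _ eps0.
  near=> v; rewrite /= !fctE opprD addrA; have vdel : `|v| < del by near: v; apply: nbhs0_lt.
  have := Hdel (v + a) a; rewrite /= addrK subrr normr0; apply => //.

have dE : 'd (F : V -> R^o) a = Ll :> (V -> R^o) by exact: diff_unique.
have dF : differentiable (F : V -> R^o) a.
  by apply/diff_locallyP; rewrite dE; split.
by split=> // v; rewrite deriveE// dE.
Unshelve. all: by end_near. Qed.

(** By homogeneity the comparison of derivatives on small vectors extends to
    the vector [v]. *)
Lemma sderiv_derive_continuous F a (L_ : V -> V -> R) v (del : R) : 0 < del ->
  (forall x, `|x - a| < del -> scalable (L_ x : V -> R^o) /\
     sderiv NV abs_norm F x (L_ x)) ->
  {for a, continuous (fun x => 'D_v (F : V -> R^o) x)}.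
Proof.
move=> del0 HL; apply/(@cvgrPdist_le _ _ _ (nbhs a)) => /= eps eps0.
have aa : `|a - a| < del by rewrite subrr normr0.
have [sLa La] := HL _ aa.
pose e1 := eps / (1 + `|v|).
have v0 : 0 < 1 + `|v| by rewrite ltr_pwDl.
have e10 : 0 < e1 by rewrite divr_gt0.
have [d d0 Hd] := sderiv_uniq_near La del0 (fun x xa => (HL x xa).2) e10.
near=> x.
have xdel : `|x - a| < del.
  by rewrite distrC; near: x; apply: cvgr_dist_lt.
have xd : `|x - a| < d by rewrite distrC; near: x; apply: cvgr_dist_lt.
have [sLx Lx] := HL _ xdel.
have [_ ->] := sderiv_diff sLa La; have [_ ->] := sderiv_diff sLx Lx.
have [eta eta0 Heta] := Hd _ xd.
have [t t0 tv] : exists2 t : R, 0 < t & `|t *: v| < eta.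
  exists (eta / 2 / (1 + `|v|)) => [|]; first by rewrite !divr_gt0.
  rewrite normrZ gtr0_norm ?divr_gt0// mulrAC ltr_pdivrMr// mulrDr mulr1.
  by have := normr_ge0 v; have := mulr_ge0 (ltW eta0) (normr_ge0 v); lra.
have := Heta _ tv; rewrite /= sLx sLa.
rewrite -[X in `|X|]/(t * L_ x v - t * L_ a v) -mulrBr normrM normrZ.
rewrite (gtr0_norm t0) mulrCA ler_pM2l// distrC => /le_trans; apply.
rewrite /e1 mulrAC ler_pdivrMr// ler_wpM2l ?(ltW eps0)// lerDr.
Unshelve. all: by end_near. Qed.

End Real.

Lemma Re_ba : bounded_additive (cabs_norm R) abs_norm (@complex.Re R).
Proof.
split=> [[a b] [c d]//|]; exists 1 => // v.
by rewrite mul1r Re_le_cabs.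
Qed.

Lemma Im_ba : bounded_additive (cabs_norm R) abs_norm (@complex.Im R).
Proof.
split=> [[a b] [c d]//|]; exists 1 => // v.
by rewrite mul1r Im_le_cabs.
Qed.

Lemma cderive_sderiv r (f : 'rV[C]_r -> C) u (g : 'cV[C]_r) v :
  sderiv (cnorm_norm R r) (cabs_norm R) f u (fun v => (v *m g) 0 0) ->
  'D_v (f : 'rV[C]_r -> C^o) u = (v *m g) 0 0.
Proof.
move=> [_ Hf]; rewrite /derive; apply: cvg_lim; first exact: norm_hausdorff.
apply/(@cvgrPdist_le _ _ _ (dnbhs 0)) => /= eps eps0.
have epsR : eps = (complex.Re eps)%:C.
  by move: eps0; rewrite ltcE => /andP[/eqP]; case: (eps) => ? ? /= ->.
have e0 : 0 < complex.Re eps by move: eps0; rewrite {1}epsR ltcR.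
have v0 : 0 < 1 + cnorm v by rewrite ltr_pwDl// cnorm_ge0.
have [del del0 Hdel] := Hf _ (divr_gt0 e0 v0).
have d0 : 0 < (del / (1 + cnorm v))%:C by rewrite ltcR divr_gt0.
near=> t.
have tn0 : t != 0 by near: t; apply: withinT.
have ct0 : 0 < cabs t by rewrite cabs_gt0.
have tdel : cabs t < del / (1 + cnorm v).
  by rewrite -ltcR cabsE; near: t; apply: (@dnbhs0_lt _ (R[i]^o)).
have ctv : cnorm (t *: v) <= cabs t * cnorm v.
  apply/cnorm_leP => [|j]; first by rewrite mulr_ge0 ?cabs_ge0 ?cnorm_ge0.
  by rewrite mxE cabsM ler_wpM2l ?cabs_ge0 ?cnorm_coord.
have tvdel : cnorm (t *: v) < del.
  rewrite (le_lt_trans ctv)// (@le_lt_trans _ _ (cabs t * (1 + cnorm v)))//.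
    by rewrite ler_wpM2l ?cabs_ge0// lerDr.
  by rewrite -ltr_pdivlMr.
have /= := Hdel (t *: v + u) u; rewrite addrK subrr cnorm0.
move=> /(_ tvdel del0); rewrite -scalemxAl mxE => H.
rewrite epsR -cabsE lecR /=.
set l := (v *m g) 0 0 in H *; set f1 := f _ in H *.
have -> : l - t^-1 *: ((f1 : C^o) - f u) = - t^-1 * (f1 - f u - t * l).
  by rewrite /GRing.scale/=; field.
rewrite cabsM cabsN cabsV ler_pdivrMl// (le_trans H)//.
rewrite (le_trans (ler_wpM2l (ltW (divr_gt0 e0 v0)) ctv))//.
rewrite [leLHS](_ : _ = cabs t * (complex.Re eps * (cnorm v / (1 + cnorm v)))).
  by rewrite ler_pM2l// ler_piMr ?(ltW e0)// ler_pdivrMr// mul1r lerDr.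
by field; rewrite gt_eqF.
Unshelve. all: by end_near. Qed.

Lemma nbhs_rowP r (u : 'rV[C]_r) (U : set 'rV[C]_r) :
  nbhs (u : 'rV[C^o]_r) U <->
  exists2 eps : R, 0 < eps & forall v, cnorm (v - u) < eps -> U v.
Proof.
split=> [/nbhs_ballP[eps /= eps0 HU]|[eps eps0 HU]].
  have epsR : eps = (complex.Re eps)%:C.
    by move: eps0; rewrite ltcE => /andP[/eqP]; case: (eps) => ? ? /= ->.
  exists (complex.Re eps) => [|v vu]; first by move: eps0; rewrite {1}epsR ltcR.
  apply: HU; split=> // i j; rewrite ord1.
  have : cabs (v 0 j - u 0 j) < complex.Re eps.
    by rewrite (le_lt_trans _ vu)//; have := cnorm_coord (v - u) j; rewrite !mxE.
  by rewrite -ltcR cabsE -epsR /ball/= distrC.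
apply/nbhs_ballP; exists eps%:C => /=; first by rewrite ltcR.
move=> v [_ H]; apply: HU; apply/cnorm_ltP => // j; rewrite !mxE.
by rewrite -ltcR cabsE distrC; exact: H.
Qed.

(** The argument is normalized so that the unit interval winds once around the
    circle. *)
Definition circ (x : R) : C := cos (pi *+ 2 * x) +i* sin (pi *+ 2 * x).

(** The mean value theorem bounds the remainder by the oscillation of [f']. *)
Lemma is_derive_strict (f f' : R -> R) a :
  (forall x : R, is_derive x 1 (f : R -> R^o) (f' x)) ->
  {for a, continuous f'} ->
  sderiv abs_norm abs_norm f a (fun v => f' a * v).
Proof.
move=> Hf cf; split=> [|eps eps0].
  split=> [x y|]; first by rewrite mulrBr.
  exists (1 + `|f' a|) => [|v]; first by rewrite ltr_pwDl.
  by rewrite /= normrM mulrDl mul1r lerDr.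
have /cvgrPdist_lt /(_ _ eps0) /nbhs_ballP[del /= del0 Hdel] := cf.
exists del => // x y /= xa ya.
wlog xy : x y xa ya / y < x.
  move=> W; have [yx|xy|->] := ltgtP y x; first exact: W.
  - have -> : f x - f y - f' a * (x - y) = - (f y - f x - f' a * (y - x)) by ring.
    by rewrite normrN [`|x - y|]distrC; exact: W.
  - by rewrite !subrr mulr0 subr0 normr0 mulr0.
have cfx : {within `[y, x], continuous f}.
  apply: derivable_within_continuous => t _; exact: ex_derive.
have [t /[!in_itv]/= /andP[yt tx] ->] := MVT xy (fun t _ => Hf t) cfx.
rewrite -mulrBl normrM ler_wpM2r// distrC ltW// Hdel//.
rewrite /ball/= ltr_norml; move: xa ya; rewrite !ltr_norml.
by move=> /andP[? ?] /andP[? ?]; apply/andP; split; lra.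
Qed.

Lemma real_complex_ba : bounded_additive abs_norm (cabs_norm R) (real_complex R).
Proof.
split=> [x y|]; first by rewrite rmorphB.
by exists 1 => // v; rewrite mul1r /= cabs_real.
Qed.

Lemma circ_sderiv a :
  sderiv abs_norm (cabs_norm R) circ a
    (fun v => v%:C * ((pi *+ 2)%:C * 'i%C * circ a)).
Proof.
pose c x : R := cos (pi *+ 2 * x); pose s x : R := sin (pi *+ 2 * x).
have dc (x : R) : is_derive x 1 (c : R -> R^o) (- s x * (pi *+ 2)).
  by rewrite /c /s; apply: is_derive_eq; rewrite /GRing.scale/=; ring.
have ds (x : R) : is_derive x 1 (s : R -> R^o) (c x * (pi *+ 2)).
  by rewrite /c /s; apply: is_derive_eq; rewrite /GRing.scale/=; ring.
have cc : continuous c.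
  by move=> x; apply: differentiable_continuous; apply/derivable1_diffP.
have cs : continuous s.
  by move=> x; apply: differentiable_continuous; apply/derivable1_diffP.
have c1 : {for a, continuous (fun x => - s x * (pi *+ 2))}.
  by apply: cvgM; [apply: cvgN; exact: cs|exact: cvg_cst].
have c2 : {for a, continuous (fun x => c x * (pi *+ 2))}.
  by apply: cvgM; [exact: cc|exact: cvg_cst].
have Hc := is_derive_strict dc c1.
have Hs := is_derive_strict ds c2.
have Hc' := sderiv_comp Hc (sderiv_lin (c a) real_complex_ba).
have Hs' := sderiv_comp Hs (sderiv_lin (s a) real_complex_ba).
have Hi := sderiv_cst abs_norm (cabs_norm R) 'i%C a.
apply: sderiv_ext (sderivD Hc' (sderivM Hi Hs')) => x /=.
  by rewrite /circ -/(c x) -/(s x); simpc.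
by rewrite /circ -/(c a) -/(s a); simpc; congr (_ +i* _); ring.
Qed.

End RealCalculus.

(** * Mean values over circles *)

Section MeanValue.
Variable R : realType.
Local Notation C := R[i].
Local Notation NC := (cabs_norm R).
Local Notation mu := (@lebesgue_measure R).

Lemma circ_abs (x : R) : cabs (circ x) = 1.
Proof. by rewrite /cabs normc_def/= cos2Dsin2 sqrtr1. Qed.

Lemma circ0 : circ (0 : R) = 1.
Proof. by rewrite /circ mulr0 cos0 sin0. Qed.

Lemma circ1 : circ (1 : R) = 1.
Proof. by rewrite /circ mulr1 -[pi *+ 2]add0r cosD2pi sinD2pi cos0 sin0. Qed.

Lemma circ_neq0 (x : R) : circ x != 0.
Proof. by rewrite -cabs_eq0 circ_abs oner_eq0. Qed.

Lemma circD (x y : R) : circ (x + y) = circ x * circ y.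
Proof. by rewrite /circ mulrDr cosD sinD; simpc; congr (_ +i* _); ring. Qed.

Lemma circN (x : R) : circ (- x) = (circ x)^-1.
Proof.
apply: (mulfI (circ_neq0 x)); rewrite -circD subrr circ0 mulfV//.
exact: circ_neq0.
Qed.

Lemma circ_int (m : int) : circ (m%:~R : R) = 1.
Proof.
have H (k : nat) : circ (k%:R : R) = 1.
  by elim: k => [|k IH]; [exact: circ0|rewrite mulrSr circD IH circ1 mulr1].
case: m => k; first exact: H.
by rewrite NegzE rmorphN/= circN H invr1.
Qed.

(** After removing the integer part of [x - y], what remains is [t] in [0, 1[
    with [cos (2 pi t) = 1], that is [sin (pi t) = 0], and the sine is positive
    inside ]0, pi[. *)
Lemma circ_eq_int (x y : R) : circ x = circ y -> exists m : int, x = y + m%:~R.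
Proof.
move=> E; exists (Num.floor (x - y)).
set m : R := _%:~R; pose t := x - y - m.
have [t0 t1] : 0 <= t /\ t < 1.
  by have := floor_itv (x - y); rewrite -/m intrD => /andP[? ?];
    split; rewrite /t; lra.
have ct : circ t = 1.
  by rewrite !circD !circN E circ_int invr1 mulr1 mulfV// circ_neq0.
suff : t = 0 by rewrite /t; lra.
apply/eqP; rewrite eq_le t0 andbT leNgt; apply/negP => tp.
have : sin (pi * t) ^+ 2 = 0.
  move: ct => /(congr1 (@complex.Re R)) /=.
  by rewrite mulrnAl cos_mulr2n; have := cos2Dsin2 (pi * t); lra.
have p0 := pi_gt0 R.
move/eqP; rewrite expf_eq0/= gt_eqF// sin_gt0_pi// mulr_gt0//=.
by rewrite gtr_pMr.
Qed.

Lemma circ_inj (x y : R) : 0 < x < 1 -> 0 < y < 1 -> circ x = circ y -> x = y.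
Proof.
move=> /andP[x0 x1] /andP[y0 y1] /circ_eq_int[m E].
have : (-1 < m < 1)%R by rewrite -!(ltr_int R) rmorphN1; apply/andP; split; lra.
move=> /andP[m1 m2]; suff m0 : m = 0 by rewrite E m0 addr0.
by lia.
Qed.

(** The angle is given by the arc cosine of the real part on the upper half
    circle, and by its reflection on the lower one. *)
Lemma circ_onto (x : C) : cabs x = 1 -> exists2 s : R, 0 <= s <= 1 & x = circ s.
Proof.
case: x => a b x1.
have ab : a ^+ 2 + b ^+ 2 = 1.
  move: x1; rewrite /cabs normc_def/= => /(congr1 (fun y => y ^+ 2)).
  by rewrite sqr_sqrtr ?addr_ge0 ?sqr_ge0// expr1n.
have a1 : -1 <= a <= 1.
  by have b2 := sqr_ge0 b; apply/andP; split; nra.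
have p0 := pi_gt0 R.
have p2 : 0 < pi *+ 2 :> R by rewrite pmulrn_lgt0.
have p20 : pi *+ 2 != 0 :> R by rewrite gt_eqF.
pose s := acos a / (pi *+ 2).
have sE : pi *+ 2 * s = acos a by rewrite mulrC divfK.
have s0 : 0 <= s by rewrite divr_ge0 ?acos_ge0// pmulrn_lge0// ltW.
have s1 : s <= 1 / 2.
  have apl := acos_lepi a1; rewrite -(ler_pM2l p2) sE; lra.
have ca : cos (pi *+ 2 * s) = a by rewrite sE acosK.
have sa : sin (pi *+ 2 * s) = `|b|.
  rewrite sE sin_acos// -sqrtr_sqr; congr (Num.sqrt _); lra.
have [b0|b0] := leP 0 b.
  exists s; first by rewrite s0/=; lra.
  by rewrite /circ ca sa ger0_norm.
exists (1 - s); first by apply/andP; split; lra.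
have -> : circ (1 - s) = (circ s)^*%C.
  rewrite /circ mulrBr mulr1 [pi *+ 2 - _]addrC cosD2pi sinD2pi.
  by rewrite cosN sinN.
by rewrite /circ ca sa ltr0_norm//= opprK.
Qed.

(** The mean value property.  Let [H t] be the mean over the circle of radius
    [t].  Differentiating under the integral sign, [H' t] is the integral of
    [g t x = Re (circ x * F' (w t x))].  Since [2 pi t g t] is the derivative in
    [x] of the periodic function [Im (F (w t x))], it vanishes for nonzero [t],
    so [H delta = H 0].  The bound [M] on [F'] provides the domination. *)
Lemma mean_value_circle (F F' : C -> C) (c : C) (sigma M delta : R) :
  (forall w, cabs (w - c) < sigma -> sderiv NC NC F w (fun v => v * F' w)) ->
  (forall w, cabs (w - c) < sigma -> cabs (F' w) <= M) ->
  0 < delta < sigma ->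
  (\int[mu]_(x in `[0%R, 1%R]) complex.Re (F (c + delta%:C * circ x)))%R =
  complex.Re (F c).
Proof.
move=> HF HM /andP[d0 ds].
pose w (t x : R) : C := c + t%:C * circ x.
pose f t x := complex.Re (F (w t x)).
pose g t x := complex.Re (circ x * F' (w t x)).
have wI t x : t \in `]-sigma, sigma[ -> cabs (w t x - c) < sigma.
  rewrite in_itv/= => ts; rewrite /w addrC addKr cabsM circ_abs mulr1 cabs_real.
  by rewrite ltr_norml.
have sw t x : sderiv (abs_norm R) NC (w t) x
    (fun v => v%:C * (t%:C * ((pi *+ 2)%:C * 'i%C * circ x))).
  apply: sderiv_ext (sderivD (sderiv_cst _ _ c x)
    (sderivM (sderiv_cst _ _ t%:C x) (circ_sderiv x))) => // v.
  by rewrite mul0r !add0r mulrCA.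
have sw' t x : sderiv (abs_norm R) NC (w ^~ x) t (fun v => v%:C * circ x).
  apply: sderiv_ext (sderivD (sderiv_cst _ _ c t)
    (sderivM (sderiv_lin t (real_complex_ba R)) (sderiv_cst _ _ (circ x) t))) => // v.
  by rewrite mulr0 add0r addr0.
have sFx t x : t \in `]-sigma, sigma[ -> sderiv (abs_norm R) NC (F \o w t) x
    (fun v => v%:C * (t%:C * ((pi *+ 2)%:C * 'i%C * circ x)) * F' (w t x)).
  by move=> tI; exact: (sderiv_comp (sw t x) (HF _ (wI _ _ tI))).
have sFt t x : t \in `]-sigma, sigma[ -> sderiv (abs_norm R) NC (F \o w ^~ x) t
    (fun v => v%:C * circ x * F' (w t x)).
  by move=> tI; exact: (sderiv_comp (sw' t x) (HF _ (wI _ _ tI))).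
have dft t x : t \in `]-sigma, sigma[ ->
    is_derive (t : R) 1 (f ^~ x : R -> R^o) (g t x).
  move=> tI.
  have [|dF E] := sderiv_diff _ (sderiv_comp (sFt t x tI) (sderiv_lin _ (Re_ba R))).
    by move=> k v /=; rewrite rmorphM/= -!mulrA Re_scale.
  apply: DeriveDef; first exact/derivable1_diffP.
  by rewrite E/= -mulrA Re_scale mul1r.
have scx t x : scalable ((fun v => complex.Im
    (v%:C * (t%:C * ((pi *+ 2)%:C * 'i%C * circ x)) * F' (w t x))) : R -> R^o).
  by move=> k v /=; rewrite rmorphM/= -!mulrA Im_scale.
pose h t x := complex.Im (F (w t x)).
have hx t x : t \in `]-sigma, sigma[ ->
    is_derive (x : R) 1 (h t : R -> R^o) (pi *+ 2 * t * g t x).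
  move=> tI.
  have [|dF E] := sderiv_diff _ (sderiv_comp (sFx t x tI) (sderiv_lin _ (Im_ba R))).
    exact: scx.
  apply: DeriveDef; first exact/derivable1_diffP.
  rewrite E/= -mulrA Im_scale mul1r -!mulrA Im_scale Im_scale.
  by rewrite (mulrC 'i%C) ImiRe /g; ring.
have ch t : t \in `]-sigma, sigma[ -> continuous (fun x => pi *+ 2 * t * g t x).
  move=> tI x.
  have := @sderiv_derive_continuous R (R^o) (h t) x _ 1 1 ltr01
    (fun y _ => conj (@scx t y) (sderiv_comp (sFx t y tI) (sderiv_lin _ (Im_ba R)))).
  have -> // : (fun y => 'D_1 (h t : R -> R^o) y) = (fun y => pi *+ 2 * t * g t y).
  by apply/funext => y; have [_ ->] := hx t y tI.
have int_g t : t \in `]-sigma, sigma[ -> t != 0 ->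
    (\int[mu]_(x in `[0%R, 1%R]) g t x)%R = 0.
  move=> tI t0; have k0 : pi *+ 2 * t != 0 by rewrite mulf_neq0// gt_eqF// pmulrn_lgt0// pi_gt0.
  have gE : g t = (fun x => (pi *+ 2 * t)^-1 * (pi *+ 2 * t * g t x)).
    by apply/funext => x; rewrite mulKf.
  have cg : continuous (g t : R -> R^o).
    by rewrite gE => x; apply: cvgM; [exact: cvg_cst|exact: ch].
  have ig : mu.-integrable `[0%R, 1%R] (EFin \o g t).
    apply: continuous_compact_integrable; first exact: segment_compact.
    exact: continuous_subspaceT.
  apply: (mulfI k0); rewrite mulr0 -RintegralZl//.
  have ch' : continuous (h t : R -> R^o).
    by move=> x; apply: differentiable_continuous; apply/derivable1_diffP;
      have [] := hx t x tI.
  rewrite /Rintegral (@continuous_FTC2 _ _ (h t))//=.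
  - by rewrite /h /w circ0 circ1 subrr.
  - exact/continuous_subspaceT/ch.
  - split; first by move=> x _; have [] := hx t x tI.
    + exact/cvg_at_right_filter/ch'.
    + exact/cvg_at_left_filter/ch'.
  - by move=> x _; rewrite derive1E; have [_ ->] := hx t x tI.
(* H is differentiable on the whole interval, so it is continuous at 0, where
   the computation of its derivative above does not apply. *)
pose H t := (\int[mu]_(x in `[0%R, 1%R]) f t x)%R.
have intf t : `]-sigma, sigma[%classic t -> mu.-integrable `[0%R, 1%R] (EFin \o f t).
  move=> tI; apply: continuous_compact_integrable; first exact: segment_compact.
  apply: continuous_subspaceT => x.
  have [] := sderiv_diff _ (sderiv_comp (sFx t x tI) (sderiv_lin _ (Re_ba R))).
    by move=> k v /=; rewrite rmorphM/= -!mulrA Re_scale.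
  by move=> dF _; exact: differentiable_continuous.
have s0 : 0 < sigma by rewrite (lt_trans d0).
have M0 : 0 <= M.
  by rewrite (le_trans _ (HM c _)) ?cabs_ge0// subrr cabs0.
have intM : mu.-integrable `[0%R, 1%R] (EFin \o (fun=> M)).
  apply: continuous_compact_integrable; first exact: segment_compact.
  by apply: continuous_subspaceT => x; exact: cvg_cst.
have derf t y : `]-sigma, sigma[%classic t -> `[0%R, 1%R]%classic y -> derivable (f ^~ y : R -> R^o) t 1.
  by move=> tI _; have [] := dft t y tI.
have ubf t y : `]-sigma, sigma[%classic t -> `[0%R, 1%R]%classic y -> `|partial1of2 f t y| <= M.
  move=> tI _; rewrite partial1of2E; have [_ ->] := dft t y tI.
  by rewrite (le_trans (Re_le_cabs _))// cabsM circ_abs mul1r HM// wI.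
have mI : measurable (`[0%R, 1%R] : set R) by [].
have dH t : t \in `]-sigma, sigma[ -> derivable (H : R -> R^o) t 1.
  move=> tI; exact: (@derivable_under_integral _ _ _ mu f _ mI t (-sigma) sigma
    tI intf derf (fun=> M) (fun=> M0) intM ubf).
have dH0 t : t \in `]-sigma, sigma[ -> t != 0 -> 'D_1 (H : R -> R^o) t = 0.
  move=> tI t0; rewrite -derive1E.
  rewrite (@differentiation_under_integral _ _ _ mu f _ mI t (-sigma) sigma
    tI intf derf (fun=> M) (fun=> M0) intM ubf).
  apply: (etrans _ (int_g t tI t0)); apply: eq_Rintegral => x _.
  by rewrite partial1of2E; have [_ ->] := dft t x tI.
have subI t : t \in `[0%R, delta] -> t \in `]-sigma, sigma[.
  by rewrite !in_itv/= => /andP[t0 td]; apply/andP; split; lra.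
have cH : {within `[0%R, delta], continuous (H : R -> R^o)}.
  by apply: derivable_within_continuous => t /subI; exact: dH.
have HE t : H t = (\int[mu]_(x in `[0%R, 1%R]) f t x)%R by [].
clearbody H.
have dHI t : t \in `]0%R, delta[ -> is_derive (t : R) 1 (H : R -> R^o) 0.
  move=> tI; have tI' := subI _ (subset_itv_oo_cc tI).
  apply: DeriveDef; first exact: dH.
  by rewrite dH0//; move: tI; rewrite in_itv/= => /andP[/gt_eqF->].
have [t tI E] := MVT d0 dHI cH.
apply: (etrans (esym (HE delta))).
have -> : H delta = H 0 by apply/eqP; rewrite -subr_eq0 E mul0r.
rewrite HE /f /w (@eq_Rintegral _ _ _ mu _ (fun=> complex.Re (F c))).
  rewrite Rintegral_cst//= -[RHS]mulr1; congr (_ * _).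
  have -> : mu (`[0%R, 1%R] : set R) = 1%E.
    by rewrite lebesgue_measure_itv/= lte_fin ltr01 oppr0 adde0.
  by [].
by move=> x _; rewrite mul0r addr0.
Qed.

End MeanValue.

(** * Mean values over tori *)

Section PolydiscMeanValue.
Variable R : realType.
Local Notation C := R[i].
Local Notation NC := (cabs_norm R).
Local Notation N r := (cnorm_norm R r).

Definition torus_pt r (q : 'rV[C]_r) (delta : R) (s : 'rV[R]_r) : 'rV[C]_r :=
  \row_j (q 0 j + delta%:C * circ (s 0 j)).

(** Induction on the dimension.  The integral is iterated, so the inner one is
    the mean value for [G] with its first variable fixed on a circle, and the
    outer one is the mean value in that first variable. *)
Lemma mean_value_torus r (G : 'rV[C]_r -> C) (Gd : 'rV[C]_r -> 'cV[C]_r)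
    (q : 'rV[C]_r) (sigma M delta : R) :
  (forall w, cnorm (w - q) < sigma ->
     sderiv (N r) NC G w (fun v => (v *m Gd w) 0 0)) ->
  (forall w k, cnorm (w - q) < sigma -> cabs (Gd w k 0) <= M) ->
  0 < delta < sigma ->
  cube_Rintegral (fun s => complex.Re (G (torus_pt q delta s))) =
  complex.Re (G q).
Proof.
move=> + + /[dup] dels /andP[d0 ds]; have s0 := lt_trans d0 ds.
elim: r G Gd q => [|r IH] G Gd q HG HM.
  by rewrite /=; congr (complex.Re (G _)); apply/rowP => -[].
pose q0 := q 0 0; pose q' : 'rV[C]_r := rsubmx (q : 'M[C]_(1, 1 + r)).
have qE : q = row_mx (\row_(_ < 1) q0) q' :> 'M[C]_(1, 1 + r).
  rewrite -[LHS](hsubmxK (q : 'M[C]_(1, 1 + r))); congr row_mx.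
  by apply/rowP => j; rewrite !mxE ord1; congr (q _ _); apply/val_inj.
pose rw (w0 : C) (w' : 'rV[C]_r) : 'rV[C]_(1 + r) := row_mx (\row_(_ < 1) w0) w'.
have mul_rw w0 w' (g : 'cV[C]_r.+1) : ((rw w0 w' : 'rV[C]_r.+1) *m g) 0 0 =
    w0 * usubmx (g : 'M[C]_(1 + r, 1)) 0 0 +
    (w' *m dsubmx (g : 'M[C]_(1 + r, 1))) 0 0.
  have H (p : 'M[C]_(1 + r, 1)) : (rw w0 w' *m p) 0 0 =
      w0 * usubmx p 0 0 + (w' *m dsubmx p) 0 0.
    by rewrite -{1}[p]vsubmxK mul_row_col mxE mxE big_ord1 !mxE.
  exact: H.
have nearq w0 w' : cabs (w0 - q0) < sigma -> cnorm (w' - q') < sigma ->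
    cnorm ((rw w0 w' : 'rV[C]_r.+1) - q) < sigma.
  move=> H0 /(cnorm_ltP _ s0) H'; apply/cnorm_ltP => // j; rewrite qE /rw !mxE.
  by case: splitP => k jk; rewrite !mxE//; have := H' k; rewrite !mxE.
have torusE (x : R) (s : 'rV[R]_r) :
    torus_pt q delta (row_mx (\row_(_ < 1) x) s : 'rV[R]_(1 + r)) =
    rw (q0 + delta%:C * circ x) (torus_pt q' delta s).
  apply/rowP => j; rewrite mxE /rw [RHS]mxE [X in circ X]mxE.
  case: splitP => k jk; rewrite !mxE; congr (_ + _).
    by rewrite /q0; congr (q _ _); apply/val_inj; rewrite /= jk ord1.
  by congr (q _ _); apply/val_inj.
(* Each coordinate of a concatenated row is either the first variable or one of
   the others, so it is constant in one argument and linear in the other. *)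
have rw_coord (j : 'I_r.+1) : (forall (w : C) q, rw w q 0 j = w) \/
    exists k : 'I_r, forall w q, rw w q 0 j = q 0 k.
  case: (splitP (j : 'I_(1 + r))) => k jk; [left|right; exists k] => w p.
    by rewrite /rw (_ : (j : 'I_(1 + r)) = lshift r k) ?row_mxEl ?mxE//;
      apply/val_inj.
  by rewrite /rw (_ : (j : 'I_(1 + r)) = rshift 1 k) ?row_mxEr//;
    apply/val_inj.
have sub w0 : sderiv NC (N r.+1) (fun w => rw w q') w0 (fun v => rw v 0).
  apply: sderiv_row => j.
  have [E|E] := rw_coord j.
  - apply: (sderiv_ext (fun w => esym (E w q')) (fun w => esym (E w 0))).
    apply: sderiv_lin; split=> //; exists 1 => // v.
    by rewrite mul1r.
  - have [k Hk] := E.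
    apply: (sderiv_ext (fun w => esym (Hk w q')) _
      (sderiv_cst _ _ (q' 0 k) w0)) => v.
    by rewrite Hk mxE.
have sub' w0 w' : sderiv (N r) (N r.+1) (rw w0) w' (fun v => rw 0 v).
  apply: sderiv_row => j.
  have [E|E] := rw_coord j.
  - apply: (sderiv_ext (fun w => esym (E w0 w)) (fun w => esym (E 0 w))).
    exact: sderiv_cst.
  - have [k Hk] := E.
    apply: (sderiv_ext (fun w => esym (Hk w0 w)) (fun w => esym (Hk 0 w))).
    apply: sderiv_lin; split=> [x y|]; first by rewrite !mxE.
    by exists 1 => // v; rewrite mul1r; exact: cnorm_coord.
rewrite /=.
have -> : complex.Re (G q) = complex.Re (G (rw q0 q')) by rewrite qE.
rewrite -(@mean_value_circle R (fun w0 => G (rw w0 q'))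
  (fun w0 => usubmx (Gd (rw w0 q') : 'M[C]_(1 + r, 1)) 0 0) q0 sigma M delta)//.
- apply: eq_Rintegral => x _.
  under eq_fun do rewrite torusE.
  apply: (IH (fun w' => G (rw (q0 + delta%:C * circ x) w'))
     (fun w' => dsubmx (Gd (rw (q0 + delta%:C * circ x) w') : 'M[C]_(1 + r, 1)))).
  + move=> w' w'q.
    have xq : cabs (q0 + delta%:C * circ x - q0) < sigma.
      by rewrite addrC addKr cabsM circ_abs mulr1 cabs_real gtr0_norm.
    have := sderiv_comp (sub' (q0 + delta%:C * circ x) w') (HG _ (nearq _ _ xq w'q)).
    apply: sderiv_ext => // v.
    by rewrite /= mul_rw mul0r add0r.
  + move=> w' k w'q; rewrite mxE; apply: HM; apply: nearq => //.
    by rewrite addrC addKr cabsM circ_abs mulr1 cabs_real gtr0_norm.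
- move=> w wq.
  have qq : cnorm (q' - q') < sigma by rewrite subrr cnorm0.
  have := sderiv_comp (sub w) (HG _ (nearq _ _ wq qq)).
  apply: sderiv_ext => // v.
  by rewrite /= mul_rw mul0mx [X in _ + X]mxE addr0.
- move=> w wq; rewrite mxE; apply: HM; apply: nearq => //.
  by rewrite subrr cnorm0.
Qed.

End PolydiscMeanValue.

(** * Complementary minors of Gale dual integer matrices *)

Section ComplementaryMinors.

(** Jacobi's identity: multiply [A] by the identity matrix whose right block
    columns are replaced by those of [B]. *)
Lemma jacobi_complementary (F : comPzRingType) r d (A B : 'M[F]_(r + d)) :
  A *m B = 1%:M -> \det (ulsubmx A) = \det A * \det (drsubmx B).
Proof.
move=> AB; have : A *m block_mx 1%:M (ursubmx B) 0 (drsubmx B) =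
    block_mx (ulsubmx A) 0 (dlsubmx A) 1%:M.
  move: AB; rewrite -{1 2}[A]submxK -{1}[B]submxK !mulmx_block.
  rewrite scalar_mx_block => /eq_block_mx[_ E1 _ E2].
  by rewrite !mulmx1 !mulmx0 !addr0 E1 E2.
move=> /(congr1 determinant); rewrite det_mulmx det_ublock det_lblock det1 mul1r.
by rewrite det1 mulr1 => ->.
Qed.

(** The only units of the integers are 1 and -1. *)
Lemma det_inv_sq r (A B : 'M[int]_r) : A *m B = 1%:M -> \det A ^+ 2 = 1.
Proof.
move=> /(congr1 determinant); rewrite det_mulmx det1 => AB.
have : \det A \is a GRing.unit by apply/unitrP; exists (\det B); rewrite mulrC.
by rewrite unfold_in => /orP[]/eqP->.
Qed.

(** The rows of [E] are a basis of a saturated lattice, so they are part of a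
    basis of the whole lattice: in the Smith normal form of [E] the elementary
    divisors do not vanish because the rows are independent, and saturation
    makes the first [r] rows of [Q] integral combinations of the rows of [E]. *)
Lemma saturated_split r d (E : 'M[int]_(r, r + d)) :
  (forall c : 'rV[int]_r, c *m E = 0 -> c = 0) ->
  (forall (y : 'rV[int]_(r + d)) (k : int) (c : 'rV[int]_r), k != 0 ->
     k *: y = c *m E -> exists c', y = c' *m E) ->
  exists L Q, [/\ Q \in unitmx, \det L ^+ 2 = 1 & E = L *m usubmx (Q : 'M[int]_(r + d))].
Proof.
move=> E0 Esat.
have [L uL [Q uQ [s _ EE]]] := int_Smith_normal_form E.
pose D : 'M[int]_r := diag_mx (\row_i s`_i).
have EL : E = (L *m D) *m usubmx (Q : 'M[int]_(r + d)).
  rewrite {1}EE -!mulmxA; congr (L *m _).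
  rewrite -{1}[Q]vsubmxK.
  have -> : (\matrix_(i < r, j < r + d) (s`_i *+ (i == j :> nat)) : 'M[int]_(r, r + d)) =
      row_mx D 0.
    apply/matrixP => i j; rewrite !mxE; case: splitP => k jk; rewrite !mxE jk//.
    by rewrite (_ : (i == r + k :> nat) = false)//; apply/eqP => ik;
      have := ltn_ord i; rewrite ik ltnNge leq_addr.
  by rewrite mul_row_col mul0mx addr0.
have DQ : invmx L *m E = D *m usubmx (Q : 'M[int]_(r + d)) by rewrite EL -mulmxA mulKmx.
have rowE (i : 'I_r) : s`_i *: row i (usubmx (Q : 'M[int]_(r + d))) = row i (invmx L) *m E.
  by rewrite -row_mul DQ /D mul_diag_mx; apply/rowP => j; rewrite !mxE.
have Q1 : usubmx (Q : 'M[int]_(r + d)) *m invmx Q = row_mx 1%:M 0.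
  have := mulmxV uQ; rewrite -{1}[Q]vsubmxK mul_col_mx scalar_mx_block.
  by rewrite /block_mx => /eq_col_mx[].
have s0 (i : 'I_r) : s`_i != 0.
  apply/eqP => si0; have := rowE i; rewrite si0 scale0r => /esym/E0 Z.
  have := row1 int i; rewrite -(mulVmx uL) row_mul Z mul0mx.
  by move=> /rowP/(_ i); rewrite !mxE !eqxx.
have /choice[c Hc] : forall i : 'I_r, exists c' : 'rV[int]_r,
    row i (usubmx (Q : 'M[int]_(r + d))) = c' *m E.
  by move=> i; apply: Esat (s0 i) (rowE i).
pose B := \matrix_i c i.
have BE : usubmx (Q : 'M[int]_(r + d)) = B *m E.
  by apply/row_matrixP => i; rewrite Hc row_mul rowK.
exists (L *m D), Q; split=> //.
apply: (@det_inv_sq _ _ B); apply: mulmx1C.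
have : usubmx (Q : 'M[int]_(r + d)) *m invmx Q =
    B *m (L *m D) *m usubmx (Q : 'M[int]_(r + d)) *m invmx Q.
  by rewrite -(mulmxA B) -EL -BE.
rewrite -mulmxA Q1 mul_mx_row mulmx1 => /eq_row_mx[].
by move=> <-.
Qed.

(** Here the rows of [E] and of [H] are bases of saturated lattices that are
    orthogonal complements of each other. *)
Section GaleDuality.
Variables (r d : nat) (E : 'M[int]_(r, r + d)) (H : 'M[int]_(d, r + d)).
Hypothesis E0 : forall c : 'rV[int]_r, c *m E = 0 -> c = 0.
Hypothesis Esat : forall (y : 'rV[int]_(r + d)) (k : int) (c : 'rV[int]_r),
  k != 0 -> k *: y = c *m E -> exists c', y = c' *m E.
Hypothesis HE : H *m E^T = 0.
Hypothesis Hsat : forall y : 'rV[int]_(r + d), y *m E^T = 0 ->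
  exists c, y = c *m H.

(** A common normal form: one unimodular matrix [Q] has the lattice of [E] as the
    span of its first rows, while the last columns of its inverse span the
    lattice of [H].  The matrices [L] and [W] are the changes of basis. *)
Lemma gale_split : exists (L : 'M[int]_r) (Q : 'M[int]_(r + d)) (W : 'M[int]_d),
  [/\ Q \in unitmx, \det L ^+ 2 = 1, \det W ^+ 2 = 1,
      E = L *m usubmx Q & H = W *m (rsubmx (invmx Q))^T].
Proof.
have [L [Q [uQ L1 EL]]] := saturated_split E0 Esat.
pose Qi := invmx Q; pose S := rsubmx (Qi : 'M[int]_(r + d, r + d)).
have [Q1 Q2] : usubmx (Q : 'M[int]_(r + d)) *m S = 0 /\ dsubmx (Q : 'M[int]_(r + d)) *m S = 1%:M.
  have := mulmxV uQ; rewrite -{1}[Q]vsubmxK -[invmx Q]hsubmxK mul_col_row.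
  by rewrite scalar_mx_block => /eq_block_mx[].
have /choice[b Hb] : forall i : 'I_d, exists c, row i S^T = c *m H.
  move=> i; apply: Hsat; rewrite -row_mul -trmx_mul EL -mulmxA Q1 mulmx0.
  by rewrite trmx0; apply/rowP => j; rewrite !mxE.
pose B := \matrix_i b i.
have SB : S^T = B *m H by apply/row_matrixP => i; rewrite Hb row_mul rowK.
have uL : L \in unitmx by rewrite unitmxE -(unitrX_pos _ (n := 2))// L1 unitr1.
have Hu : H *m (usubmx (Q : 'M[int]_(r + d)))^T = 0.
  have : H *m E^T *m invmx L^T = 0 by rewrite HE mul0mx.
  by rewrite EL trmx_mul mulmxA mulmxK// unitmx_tr.
pose W := H *m (dsubmx (Q : 'M[int]_(r + d)))^T.
have HW : H = W *m S^T.
  have : H *m Q^T *m Qi^T = H by rewrite -mulmxA -trmx_mul mulVmx// trmx1 mulmx1.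
  rewrite -[Q in Q^T]vsubmxK tr_col_mx mul_mx_row Hu -[Qi]hsubmxK tr_row_mx.
  by rewrite mul_row_col mul0mx add0r.
have BW : B *m W = 1%:M.
  have : S^T *m (dsubmx (Q : 'M[int]_(r + d)))^T = 1%:M by rewrite -trmx_mul Q2 trmx1.
  by rewrite {1}SB -mulmxA.
by exists L, Q, W; split=> //; apply: (@det_inv_sq _ _ B); exact: mulmx1C.
Qed.

(** Up to squares of determinants 1 and -1, the two sides are complementary
    minors of the mutually inverse matrices [q X^-1 q^T] and [q^-T X q^-1], and
    the first of these has determinant the inverse of the product of the
    [x i]. *)
Lemma gale_det_split (F : fieldType) (x : 'I_(r + d) -> F) :
  (forall i, x i != 0) ->
  \prod_i x i * \det (map_mx intr E *m diag_mx (\row_i (x i)^-1) *m map_mx intr E^T)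
  = \det (map_mx intr H *m diag_mx (\row_i x i) *m map_mx intr H^T).
Proof.
move=> x0; have [L [Q [W [uQ L1 W1 EL HW]]]] := gale_split.
pose Qi := invmx Q; pose S := rsubmx (Qi : 'M[int]_(r + d, r + d)).
have sq m (A : 'M[int]_m) (Y : 'M[F]_m) : \det A ^+ 2 = 1 ->
    \det (map_mx intr A *m Y *m (map_mx intr A)^T) = \det Y.
  move=> A1; rewrite !det_mulmx det_tr mulrAC -expr2 det_map_mx/= -rmorphXn/= A1.
  by rewrite rmorph1 mul1r.
pose q : 'M[F]_(r + d) := map_mx intr Q.
pose qi : 'M[F]_(r + d) := map_mx intr Qi.
have qqi : q *m qi = 1%:M by rewrite -map_mxM mulmxV// map_mx1.
pose X := diag_mx (\row_i x i); pose Xi := diag_mx (\row_i (x i)^-1).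
have XX : Xi *m X = 1%:M.
  apply/matrixP => i j; rewrite mul_diag_mx !mxE.
  by have [->|ij] := eqVneq; rewrite ?mulr1n ?mulr0n ?mulr0// mulVf.
have NN : (q *m Xi *m q^T) *m (qi^T *m X *m qi) = 1%:M.
  rewrite -!mulmxA (mulmxA q^T) -trmx_mul (mulmx1C qqi) trmx1 mul1mx (mulmxA Xi).
  by rewrite XX mul1mx.
have J := jacobi_complementary NN.
have ulE : ulsubmx (q *m Xi *m q^T) =
    map_mx intr (usubmx (Q : 'M[int]_(r + d))) *m Xi *m (map_mx intr (usubmx (Q : 'M[int]_(r + d))))^T.
  rewrite map_usubmx -/q -{1 2}[q]vsubmxK tr_col_mx !mul_col_mx mul_mx_row.
  rewrite -[X in ulsubmx (col_mx X _)]hsubmxK.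
  rewrite /ulsubmx col_mxKu.
  by rewrite hsubmxK row_mxKl.
have drE : drsubmx (qi^T *m X *m qi) =
    (map_mx intr S^T) *m X *m (map_mx intr S^T)^T.
  rewrite -{1 2}[qi]hsubmxK tr_row_mx !mul_col_mx.
  rewrite /drsubmx col_mxKd mul_mx_row row_mxKr /qi -map_rsubmx -/S.
  by rewrite -!map_trmx trmxK.
have detq : \det q ^+ 2 = 1.
  rewrite /q det_map_mx/= -rmorphXn/= (det_inv_sq (B := Qi)) ?rmorph1//.
  exact: mulmxV.
have detN : \det (q *m Xi *m q^T) = \prod_i (x i)^-1.
  rewrite !det_mulmx det_tr mulrAC -expr2 detq mul1r det_diag.
  by apply: eq_bigr => i _; rewrite mxE.
have -> : map_mx intr E *m Xi *m map_mx intr E^T =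
    map_mx intr L *m ulsubmx (q *m Xi *m q^T) *m (map_mx intr L)^T.
  by rewrite ulE -map_trmx EL map_mxM trmx_mul !mulmxA.
have -> : map_mx intr H *m X *m map_mx intr H^T =
    map_mx intr W *m drsubmx (qi^T *m X *m qi) *m (map_mx intr W)^T.
  by rewrite drE -map_trmx {1 2}HW map_mxM trmx_mul !mulmxA.
rewrite !sq// J detN mulrA -big_split/= big1 ?mul1r// => i _.
by rewrite mulfV.
Qed.


Lemma gale_kernel_split (F : fieldType) (x : 'cV[F]_(r + d)) :
  map_mx intr H *m x = 0 -> exists c, x = (map_mx intr E)^T *m c.
Proof.
have [L [Q [W [uQ L1 W1 EL HW]]]] := gale_split.
have unit_sq m (A : 'M[int]_m) : \det A ^+ 2 = 1 -> (map_mx intr A : 'M[F]_m) \in unitmx.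
  move=> A1; rewrite unitmxE det_map_mx -(unitrX_pos _ (n := 2))//.
  by rewrite -rmorphXn A1 rmorph1 unitr1.
pose q : 'M[F]_(r + d) := map_mx intr Q.
pose qi : 'M[F]_(r + d) := map_mx intr (invmx Q).
rewrite HW map_mxM -mulmxA => /(congr1 (mulmx (invmx (map_mx intr W)))).
rewrite mulKmx ?unit_sq// mulmx0 -map_trmx map_rsubmx -/qi => S0.
have xE : x = (usubmx q)^T *m ((lsubmx qi)^T *m x).
  have : q^T *m qi^T *m x = x.
    by rewrite -trmx_mul -map_mxM mulVmx// map_mx1 trmx1 mul1mx.
  rewrite -{1}[q]vsubmxK -{1}[qi]hsubmxK tr_col_mx tr_row_mx mul_row_col.
  by rewrite mulmxDl -!mulmxA S0 mulmx0 addr0.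
exists ((invmx (map_mx intr L))^T *m ((lsubmx qi)^T *m x)).
rewrite EL map_mxM trmx_mul map_usubmx -/q {1}xE -mulmxA.
congr (_ *m _); rewrite mulmxA -trmx_mul mulVmx ?unit_sq// trmx1 mul1mx.
by [].
Qed.

End GaleDuality.

(** The dimension of the middle space is a variable [n], equal to [r + d] only by
    a proof. *)
Section GaleDualityCast.
Variables (r d n : nat) (E : 'M[int]_(r, n)) (H : 'M[int]_(d, n)).
Hypothesis nE : n = (r + d)%N.
Hypothesis E0 : forall c : 'rV[int]_r, c *m E = 0 -> c = 0.
Hypothesis Esat : forall (y : 'rV[int]_n) (k : int) (c : 'rV[int]_r),
  k != 0 -> k *: y = c *m E -> exists c', y = c' *m E.
Hypothesis HE : H *m E^T = 0.
Hypothesis Hsat : forall y : 'rV[int]_n, y *m E^T = 0 -> exists c, y = c *m H.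

Lemma gale_det (F : fieldType) (x : 'I_n -> F) : (forall i, x i != 0) ->
  \prod_i x i * \det (map_mx intr E *m diag_mx (\row_i (x i)^-1) *m map_mx intr E^T)
  = \det (map_mx intr H *m diag_mx (\row_i x i) *m map_mx intr H^T).
Proof.
move: E H E0 Esat HE Hsat x; rewrite nE => E' H' a b c f x x0.
exact: (gale_det_split a b c f x0).
Qed.

Lemma gale_kernel (F : fieldType) (x : 'cV[F]_n) :
  map_mx intr H *m x = 0 -> exists c, x = (map_mx intr E)^T *m c.
Proof.
move: E H E0 Esat HE Hsat x; rewrite nE => E' H' a b c f x x0.
exact: (gale_kernel_split a b c f x0).
Qed.

End GaleDualityCast.

End ComplementaryMinors.

(** * The lattices of the exact sequence *)

Lemma Re_sum (R : rcfType) (I : Type) (s : seq I) (P : pred I) (F : I -> R[i]) :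
  complex.Re (\sum_(i <- s | P i) F i) = \sum_(i <- s | P i) complex.Re (F i).
Proof. by apply: (big_morph (@complex.Re R)) => // -[? ?] []. Qed.

Lemma Im_sum (R : rcfType) (I : Type) (s : seq I) (P : pred I) (F : I -> R[i]) :
  complex.Im (\sum_(i <- s | P i) F i) = \sum_(i <- s | P i) complex.Im (F i).
Proof. by apply: (big_morph (@complex.Im R)) => // -[? ?] []. Qed.

Section Lattices.
Variables (R : realType) (r n d : nat) (S : lattice_seq R r n d).
Local Notation C := R[i].
Local Notation a := (sp_a S).
Local Notation t := (sp_t S).

Lemma alphaE i x : alpha S i x = coord (omega S) i (Defs.iota S x) :> R.
Proof. by rewrite /alpha /mu comp_lfunE /omega_dual lfunE. Qed.

Lemma omega_sum x : x = \sum_i (coord (omega S) i x : R) *: tnth (omega S) i.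
Proof.
rewrite {1}(coord_basis (omega_basis S) (memvf x)).
by apply: eq_bigr => i _; rewrite (tnth_nth 0).
Qed.

Lemma omega_free (c : 'I_n -> R) i :
  coord (omega S) i (\sum_i c i *: tnth (omega S) i) = c i.
Proof.
under eq_bigr do rewrite (tnth_nth 0).
by rewrite coord_sum_free// (basis_free (omega_basis S)).
Qed.

Lemma coord_omega i j : coord (omega S) j (tnth (omega S) i) = (i == j)%:R :> R.
Proof. by rewrite (tnth_nth 0) coord_free// (basis_free (omega_basis S)). Qed.

Lemma Zspan_omega x : Zspan (omega S) x <->
  forall i, (coord (omega S) i x : R) \is a Num.int.
Proof.
split=> [[c ->] i|H].
  under eq_bigr do rewrite -scaler_int.
  by rewrite omega_free intr_int.
exists (fun i => Num.floor (coord (omega S) i x : R)).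
rewrite {1}[x]omega_sum; apply: eq_bigr => i _.
by rewrite -scaler_int floorK.
Qed.

Lemma Gamma_aP x : Gamma_a S x <-> forall i, (alpha S i x : R) \is a Num.int.
Proof.
rewrite /Gamma_a /Gamma_g /=; split=> [/Zspan_omega H i|H].
  by rewrite alphaE.
by apply/Zspan_omega => i; rewrite -alphaE.
Qed.

Lemma iota_inj0 x : Defs.iota S x = 0 -> x = 0.
Proof.
move=> x0; apply/eqP; rewrite -memv0 -(iota_inj S) memv_ker.
exact/eqP.
Qed.

Lemma alpha_inj x : (forall i, alpha S i x = 0 :> R) -> x = 0.
Proof.
move=> H; apply: iota_inj0; rewrite [Defs.iota S x]omega_sum big1// => i _.
by rewrite -alphaE H scale0r.
Qed.

Lemma proj_iota x : Defs.proj S (Defs.iota S x) = 0.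
Proof.
apply/eqP; rewrite -memv_ker -iota_proj_exact.
by rewrite memv_img// memvf.
Qed.

Lemma proj_eq0 y : Defs.proj S y = 0 -> exists x, y = Defs.iota S x.
Proof.
move=> y0; have : y \in lker (Defs.proj S) by rewrite memv_ker y0.
by rewrite -iota_proj_exact => /memv_imgP[x _ ->]; exists x.
Qed.

Lemma proj_onto x : exists y, x = Defs.proj S y.
Proof.
have : x \in limg (Defs.proj S) by rewrite proj_surj memvf.
by move=> /memv_imgP[y _ ->]; exists y.
Qed.

Lemma dim_seq : n = (r + d)%N.
Proof.
have := limg_ker_dim (Defs.proj S) fullv.
rewrite capfv -iota_proj_exact proj_surj dim_t.
have := limg_ker_dim (Defs.iota S) fullv.
rewrite iota_inj capfv dimv0 add0n dim_a => ->.
move=> ->; have /andP[/eqP <- fr] := omega_basis S.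
by move: fr; rewrite /free => /eqP ->; rewrite size_tuple.
Qed.

Section Basis.
Variable e : r.-tuple a.
Hypothesis he : is_Zbasis (Gamma_a S) e.

Lemma Zbasis_mem k : Gamma_a S (tnth e k).
Proof.
rewrite -he.1; exists (fun j => (j == k)%:Z).
rewrite (bigD1 k)//= eqxx mulr1z big1 ?addr0// => j /negbTE ->.
by rewrite mulr0z.
Qed.

Lemma pairingE i k : (pairing e i k)%:~R = alpha S i (tnth e k) :> R.
Proof. by rewrite /pairing floorK// (Gamma_aP _).1//; exact: Zbasis_mem. Qed.

(** The lattice has full rank, so its [r] generators span a space of dimension
    [r]. *)
Lemma Zbasis_basis : basis_of fullv e.
Proof.
have [b bb bG] := a_full_rank S.
rewrite basisEdim dim_a size_tuple leqnn andbT -(span_basis bb).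
apply/span_subvP => y /tnthP[i ->].
have := bG i; rewrite -/(Gamma_g S) -[X in X -> _]/(Gamma_a S (tnth b i)) -he.1.
move=> [c ->]; apply: memv_suml => k _; rewrite -scaler_int memvZ//.
by rewrite memv_span// mem_tnth.
Qed.

Lemma Zbasis_sum x : x = \sum_k (coord e k x : R) *: tnth e k.
Proof.
rewrite {1}(coord_basis Zbasis_basis (memvf x)).
by apply: eq_bigr => i _; rewrite (tnth_nth 0).
Qed.

Lemma Zbasis_free (c : 'I_r -> R) k : coord e k (\sum_k c k *: tnth e k) = c k.
Proof.
under eq_bigr do rewrite (tnth_nth 0).
by rewrite coord_sum_free// (basis_free Zbasis_basis).
Qed.

Definition pair_mx : 'M[int]_(r, n) := \matrix_(k, i) pairing e i k.

Lemma pair_mxE (c : 'rV[int]_r) i :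
  ((c *m pair_mx) 0 i)%:~R = alpha S i (\sum_k tnth e k *~ c 0 k) :> R.
Proof.
rewrite mxE rmorph_sum linear_sum; apply: eq_bigr => k _.
by rewrite rmorphM/= !mxE pairingE raddfMz mulrzl.
Qed.

Lemma pair_mx_inj (c : 'rV[int]_r) : c *m pair_mx = 0 -> c = 0.
Proof.
move=> c0; apply/rowP => k; rewrite mxE; apply: (he.2 (fun k => c 0 k)).
by apply: alpha_inj => i; rewrite -pair_mxE c0 mxE.
Qed.

(** The lattice of [a] consists of all vectors of [a] that are integral in [g],
    so it contains every vector of [a] with an integral multiple in it. *)
Lemma pair_mx_saturated (y : 'rV[int]_n) (k : int) (c : 'rV[int]_r) : k != 0 ->
  k *: y = c *m pair_mx -> exists c', y = c' *m pair_mx.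
Proof.
move=> k0 E; pose x := (k%:~R^-1 : R) *: (\sum_k tnth e k *~ c 0 k).
have k0R : k%:~R != 0 :> R by rewrite intr_eq0.
have xy i : alpha S i x = (y 0 i)%:~R :> R.
  rewrite /x linearZ/= -pair_mxE -E mxE rmorphM/=.
  by rewrite /GRing.scale/= mulKf.
have : Gamma_a S x by apply/Gamma_aP => i; rewrite xy intr_int.
rewrite -he.1 => -[c' xc]; exists (\row_k c' k); apply/rowP => i.
apply: (@intr_inj R); rewrite -xy pair_mxE xc; congr (alpha S i _ : R).
by apply: eq_bigr => j _; rewrite mxE.
Qed.

End Basis.

Section TwoBases.
Variables e lam : r.-tuple a.
Hypothesis he : is_Zbasis (Gamma_a S) e.
Hypothesis hlam : is_Zbasis (Gamma_a S) lam.
Hypothesis hor : same_orientation e lam.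

(** Two bases of one lattice differ by a unimodular matrix, and the orientation
    excludes the determinant -1. *)
Lemma basis_change : exists2 T : 'M[int]_r, \det T = 1 &
  pair_mx lam = T *m pair_mx e.
Proof.
have HT j : exists c : 'I_r -> int, tnth lam j = \sum_k tnth e k *~ c k.
  by have := Zbasis_mem hlam j; rewrite -he.1.
have HT' j : exists c : 'I_r -> int, tnth e j = \sum_k tnth lam k *~ c k.
  by have := Zbasis_mem he j; rewrite -hlam.1.
have [c Hc] := choice HT; have [c' Hc'] := choice HT'.
pose T := \matrix_(j, k) c j k; pose T' := \matrix_(j, k) c' j k.
have TT : T' *m T = 1%:M.
  apply/matrixP => i j; apply/eqP; rewrite -subr_eq0; apply/eqP.
  apply: (he.2 (fun j => (T' *m T) i j - (1%:M : 'M[int]_r) i j)).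
  under eq_bigr do rewrite mulrzBr.
  rewrite sumrB [X in _ - X](_ : _ = tnth e i); last first.
    rewrite (bigD1 i)//= mxE eqxx mulr1z big1 ?addr0// => k ki.
    by rewrite mxE eq_sym (negbTE ki) mulr0z.
  apply/eqP; rewrite subr_eq0; apply/eqP; rewrite [RHS]Hc'.
  transitivity (\sum_k \sum_l tnth e k *~ (c l k * c' i l)).
    apply: eq_bigr => k _; rewrite mxE mulrz_sumr; apply: eq_bigr => l _.
    by rewrite !mxE mulrC.
  rewrite exchange_big; apply: eq_bigr => l _; rewrite Hc mulrz_suml.
  by apply: eq_bigr => k _; rewrite mulrzA.
exists T; last first.
  apply/matrixP => j i; apply: (@intr_inj R).
  rewrite mxE (pairingE hlam) Hc linear_sum mxE rmorph_sum.
  apply: eq_bigr => k _; rewrite rmorphM/= !mxE (pairingE he) raddfMz mulrzl.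
  by [].
have detT : (\det T)%:~R = \det (\matrix_(j < r, k < r) (coord e k (tnth lam j) : R)).
  rewrite -det_map_mx; congr (\det _); apply/matrixP => j k; rewrite !mxE Hc.
  under eq_bigr do rewrite -scaler_int.
  by rewrite Zbasis_free.
have T0 : 0 < \det T by move: hor; rewrite /same_orientation -detT ltr0z.
have : \det T ^+ 2 = 1 by apply: (@det_inv_sq _ _ T'); exact: mulmx1C.
by move=> /eqP; rewrite sqrf_eq1 => /orP[/eqP//|/eqP E]; move: T0; rewrite E.
Qed.

End TwoBases.

Section DualBasis.
Variables (e : r.-tuple a) (h : d.-tuple 'Hom(t, R^o)).
Hypothesis he : is_Zbasis (Gamma_a S) e.
Hypothesis hh : is_Zbasis (dual_lattice (Gamma_t S)) h.

Lemma beta_Gamma i : Gamma_t S (beta S i).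
Proof.
exists (tnth (omega S) i) => //; apply/Zspan_omega => j.
by rewrite coord_omega; case: eqP.
Qed.

Lemma h_dual k : dual_lattice (Gamma_t S) (tnth h k).
Proof.
rewrite -hh.1; exists (fun j => (j == k)%:Z).
rewrite (bigD1 k)//= eqxx mulr1z big1 ?addr0// => j /negbTE ->.
by rewrite mulr0z.
Qed.

Definition h_mx : 'M[int]_(d, n) :=
  \matrix_(k, i) Num.floor (tnth h k (beta S i) : R).

Lemma h_mxE k i : (h_mx k i)%:~R = tnth h k (beta S i) :> R.
Proof. by rewrite mxE floorK//; apply: h_dual; exact: beta_Gamma. Qed.

Lemma sum_alpha_beta x : \sum_i (alpha S i x : R) *: beta S i = 0.
Proof.
rewrite -[RHS](proj_iota x) [in RHS](omega_sum (Defs.iota S x)) linear_sum.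
by apply: eq_bigr => i _; rewrite linearZ/= alphaE.
Qed.

Lemma h_mx_orth : h_mx *m (pair_mx e)^T = 0.
Proof.
apply/matrixP => k j; apply: (@intr_inj R); rewrite mxE rmorph_sum mxE.
transitivity (tnth h k (\sum_i (alpha S i (tnth e j) : R) *: beta S i) : R).
  rewrite linear_sum; apply: eq_bigr => i _.
  rewrite rmorphM/= h_mxE !mxE (pairingE he) linearZ/= mulrC.
  by [].
by rewrite sum_alpha_beta linear0.
Qed.

(** An integral form on [g] that vanishes on [a] factors through [t], where it is
    integral on the image of the lattice, hence in the dual lattice spanned by
    [h]. *)
Lemma h_mx_orth_complete (y : 'rV[int]_n) : y *m (pair_mx e)^T = 0 ->
  exists c, y = c *m h_mx.
Proof.
move=> y0.
pose ly : 'Hom(sp_g S, R^o) := \sum_i ((y 0 i)%:~R : R) *: omega_dual S i.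
have lyE x : ly x = \sum_i (y 0 i)%:~R * (coord (omega S) i x : R) :> R.
  rewrite sum_lfunE; apply: eq_bigr => i _.
  by rewrite scale_lfunE /omega_dual lfunE.
have ly_iota x : ly (Defs.iota S x) = 0.
  rewrite [x](Zbasis_sum he) !linear_sum big1// => k _; rewrite !linearZ/=.
  have -> : ly (Defs.iota S (tnth e k)) = 0; last by rewrite scaler0.
  have /rowP/(_ k)/(congr1 (fun z : int => z%:~R : R)) := y0.
  rewrite !mxE rmorph_sum/= => E; rewrite lyE -[RHS]E; apply: eq_bigr => i _.
  by rewrite rmorphM/= !mxE (pairingE he) alphaE.
pose l : 'Hom(t, R^o) := (ly \o (Defs.proj S)^-1)%VF.
have l_proj x : l (Defs.proj S x) = ly x.
  rewrite /l comp_lfunE /=; apply/eqP; rewrite -subr_eq0 -linearB/=.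
  have [x' ->] : exists x', (Defs.proj S)^-1%VF (Defs.proj S x) - x = Defs.iota S x'.
    by apply: proj_eq0; rewrite linearB/= limg_lfunVK ?memv_img ?memvf// subrr.
  by rewrite ly_iota.
have : dual_lattice (Gamma_t S) l.
  move=> _ [v /Zspan_omega Hv <-]; rewrite l_proj lyE rpred_sum// => i _.
  by rewrite rpredM// intr_int.
rewrite -hh.1 => -[c lc]; exists (\row_k c k); apply/rowP => i.
apply: (@intr_inj R); rewrite mxE rmorph_sum.
have -> : (y 0 i)%:~R = l (beta S i) :> R.
  rewrite l_proj lyE (bigD1 i)//= coord_omega eqxx mulr1 big1 ?addr0// => k ki.
  by rewrite coord_omega eq_sym (negbTE ki) mulr0.
rewrite lc sum_lfunE; apply: eq_bigr => k _.
by rewrite rmorphM/= h_mxE -scaler_int scale_lfunE mxE.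
Qed.

End DualBasis.

Section Gale.
Variables (e lam : r.-tuple a) (h : d.-tuple 'Hom(t, R^o)).
Hypothesis he : is_Zbasis (Gamma_a S) e.
Hypothesis hlam : is_Zbasis (Gamma_a S) lam.
Hypothesis hor : same_orientation e lam.
Hypothesis hh : is_Zbasis (dual_lattice (Gamma_t S)) h.

Let E0 := pair_mx_inj he.
Let Esat := pair_mx_saturated he.
Let HE := h_mx_orth he hh.
Let Hsat := h_mx_orth_complete he hh.

Lemma alphaC i k : (alpha S i (tnth e k) : R)%:C = (pairing e i k)%:~R :> C.
Proof. by rewrite -(pairingE he) rmorph_int. Qed.

Lemma hC k i : (tnth h k (beta S i) : R)%:C = (h_mx h k i)%:~R :> C.
Proof. by rewrite -(h_mxE hh) rmorph_int. Qed.

(** This identity matches the Hessian on the B-side with the Jacobian of the map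
    [p]: the pairings with [e] and the values of [h] on the [beta i] are Gale
    dual integer matrices, and replacing one factor [e] by [lam] multiplies the
    determinant by 1. *)
Lemma D_B_gale (x : 'I_n -> C) : (forall i, x i != 0) ->
  \prod_i x i * \det (\matrix_(k < r, j < r)
    \sum_i (alpha S i (tnth e k) : R)%:C * (pairing lam i j)%:~R / x i) =
  D_B h x.
Proof.
move=> x0; have [T T1 lamT] := basis_change he hlam hor.
have -> : D_B h x = \det (map_mx intr (h_mx h) *m diag_mx (\row_i x i) *m map_mx intr (h_mx h)^T).
  congr (\det _); apply/matrixP => j k; rewrite mul_mx_diag !mxE.
  by apply: eq_bigr => i _; rewrite !hC !mxE mulrAC.
rewrite -(gale_det dim_seq E0 Esat HE Hsat x0); congr (_ * _).
rewrite [X in \det X](_ : _ = map_mx intr (pair_mx e) *m diag_mx (\row_i (x i)^-1)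
   *m map_mx intr (pair_mx e)^T *m map_mx intr T^T).
  by rewrite det_mulmx det_map_mx det_tr T1 mulr1.
rewrite -mulmxA -map_mxM -trmx_mul -lamT.
apply/matrixP => k j; rewrite mul_mx_diag !mxE.
by apply: eq_bigr => i _; rewrite !mxE alphaC mulrAC.
Qed.

(** The complexified exact sequence at [g], in coordinates. *)
Lemma cform_onto (x : 'I_n -> C) :
  (forall k, \sum_i x i * (tnth h k (beta S i) : R)%:C = 0) ->
  exists u, forall i, cform e (alpha S i) u = x i.
Proof.
move=> Hx; have [|c xc] := @gale_kernel _ _ _ _ _ dim_seq E0 Esat HE Hsat _ (\col_i x i).
  apply/colP => k; rewrite !mxE -[RHS](Hx k); apply: eq_bigr => i _.
  by rewrite hC !mxE mulrC.
exists c^T => i; have /colP/(_ i) := xc; rewrite !mxE => ->.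
by apply: eq_bigr => k _; rewrite !mxE alphaC.
Qed.

Lemma cformB l u v : cform e l (u - v) = cform e l u - cform e l v.
Proof.
by rewrite /cform -sumrB; apply: eq_bigr => j _; rewrite !mxE mulrBr.
Qed.

Lemma cform_inj u v :
  (forall i, cform e (alpha S i) u = cform e (alpha S i) v) -> u = v.
Proof.
move=> H; apply/eqP; rewrite -subr_eq0; apply/eqP; set w := u - v.
have {}H i : cform e (alpha S i) w = 0 by rewrite cformB H subrr.
have zero (f : 'I_r -> R) :
    (forall i, \sum_j (alpha S i (tnth e j) : R) * f j = 0) -> forall j, f j = 0.
  move=> Hf j; have f0 : \sum_k f k *: tnth e k = 0.
    apply: alpha_inj => i; rewrite linear_sum -[RHS](Hf i).
    by apply: eq_bigr => k _; rewrite linearZ/= mulrC.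
  by rewrite -(Zbasis_free he f j) f0 linear0.
apply/rowP => j; rewrite [RHS]mxE; apply/eqP; rewrite eq_complex; apply/andP.
split; apply/eqP; [apply: (zero (fun j => complex.Re (w 0 j)))|
  apply: (zero (fun j => complex.Im (w 0 j)))] => i.
- transitivity (complex.Re (cform e (alpha S i) w)); last by rewrite H.
  rewrite /cform Re_sum; apply: eq_bigr => k _.
  by case: (w 0 k) => ? ? /=; rewrite mul0r subr0.
- transitivity (complex.Im (cform e (alpha S i) w)); last by rewrite H.
  rewrite /cform Im_sum; apply: eq_bigr => k _.
  by case: (w 0 k) => ? ? /=; rewrite mul0r addr0.
Qed.

Lemma cform_kappa u : cform e (kappa S) u = \sum_i cform e (alpha S i) u.
Proof.
rewrite /cform exchange_big; apply: eq_bigr => j _ /=.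
by rewrite -mulr_suml; congr (_ * _); rewrite /kappa sum_lfunE rmorph_sum.
Qed.

End Gale.
End Lattices.

(** * Characters of the torus *)

Section Torus.
Variables (R : realType) (r n d : nat) (S : lattice_seq R r n d).
Local Notation C := R[i].
Local Notation a := (sp_a S).
Local Notation t := (sp_t S).
Implicit Types (w : torus S) (b : t).

Lemma e_E b w : e_ b w =
  (expR (- (pi *+ 2 * (repr w).2 b)))%:C * circ ((repr w).1 b : R).
Proof.
rewrite /e_ /pairC; set x := (repr w).1 b; set y := (repr w).2 b.
have -> : (pi *+ 2)%:C * 'i%C * (x +i* y) = (- (pi *+ 2 * y)) +i* (pi *+ 2 * x) :> C.
  by simpc.
by rewrite /cexp /circ.
Qed.

Lemma e_neq0 b w : e_ b w != 0.
Proof.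
rewrite e_E mulf_neq0 ?circ_neq0//.
by rewrite -cabs_eq0 cabs_real normr_eq0 gt_eqF// expR_gt0.
Qed.

Lemma e_D b c w : e_ (b + c) w = e_ b w * e_ c w.
Proof.
rewrite !e_E !linearD/= mulrDr opprD expRD circD rmorphM/=; ring.
Qed.

Lemma e_0 w : e_ 0 w = 1.
Proof. by rewrite e_E !linear0 mulr0 oppr0 expR0 circ0 mulr1. Qed.

Lemma e_N b w : e_ (- b) w = (e_ b w)^-1.
Proof.
apply: (mulfI (e_neq0 b w)); rewrite -e_D subrr e_0 mulfV//.
exact: e_neq0.
Qed.

Lemma e_Mz b (m : int) w : e_ (b *~ m) w = e_ b w ^ m.
Proof.
have H (k : nat) : e_ (b *+ k) w = e_ b w ^+ k.
  by elim: k => [|k IH]; [rewrite mulr0n e_0|rewrite mulrS e_D IH exprS].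
case: m => k; first exact: H.
by rewrite NegzE mulrNz e_N -pmulrn H exprnN.
Qed.

Lemma e_sum (m : 'I_n -> int) (b : 'I_n -> t) w :
  e_ (\sum_i b i *~ m i) w = \prod_i e_ (b i) w ^ m i.
Proof.
elim/big_rec2 : _ => [|i x y _ <-]; first exact: e_0.
by rewrite e_D e_Mz.
Qed.

Lemma beta_span x : exists c : 'I_n -> R, x = \sum_i c i *: beta S i.
Proof.
have [y ->] := proj_onto x; exists (fun i => coord (omega S) i y : R).
by rewrite {1}(omega_sum y) linear_sum; apply: eq_bigr => i _; rewrite linearZ.
Qed.

Lemma Gamma_t_span x : Gamma_t S x -> exists c : 'I_n -> int,
  x = \sum_i beta S i *~ c i.
Proof.
move=> [y [c ->] <-]; exists c; rewrite linear_sum.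
by apply: eq_bigr => i _; rewrite raddfMz.
Qed.

(** The absolute values determine the imaginary part of a point of the torus and
    the arguments determine its real part up to integers; the [beta i] span the
    lattice and the vector space [t]. *)
Lemma torus_inj w w' : (forall i, e_ (beta S i) w = e_ (beta S i) w') -> w = w'.
Proof.
move=> H.
have H2 i : (repr w).2 (beta S i) = (repr w').2 (beta S i) :> R.
  have := congr1 (@cabs R) (H i); rewrite !e_E !cabsM !circ_abs !mulr1 !cabs_real.
  rewrite !gtr0_norm ?expR_gt0// => /expR_inj/oppr_inj.
  by apply: mulfI; rewrite gt_eqF// pmulrn_lgt0// pi_gt0.
have H1 i : (repr w).1 (beta S i) - (repr w').1 (beta S i) \is a @Num.int R.
  have := H i; rewrite !e_E H2 => /mulfI.
  have -> : (expR (- (pi *+ 2 * (repr w').2 (beta S i))))%:C != 0 :> C.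
    by rewrite -cabs_eq0 cabs_real normr_eq0 gt_eqF// expR_gt0.
  move=> /(_ isT)/circ_eq_int[m ->]; rewrite addrC addKr.
  exact: intr_int.
rewrite -[w]reprK -[w']reprK; apply/eqmodP; apply/andP; split; last first.
  apply/eqP/lfunP => x; have [c ->] := beta_span x; rewrite !linear_sum.
  by apply: eq_bigr => i _; rewrite !linearZ/= H2.
apply/asboolP => x /Gamma_t_span[c ->]; rewrite linear_sum rpred_sum// => i _.
rewrite raddfMz/= rpredMz// add_lfunE opp_lfunE; exact: H1.
Qed.

Section Points.
Variables (e lam : r.-tuple a) (h : d.-tuple 'Hom(t, R^o)) (z : 'I_n -> C).
Hypothesis he : is_Zbasis (Gamma_a S) e.
Hypothesis hlam : is_Zbasis (Gamma_a S) lam.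
Hypothesis hh : is_Zbasis (dual_lattice (Gamma_t S)) h.
Hypothesis hz : forall i, z i != 0.

Lemma ze_neq0 w i : ze z w i != 0.
Proof. by rewrite mulf_neq0// e_neq0. Qed.

Lemma ze_inj w w' : (forall i, ze z w i = ze z w' i) -> w = w'.
Proof. by move=> H; apply: torus_inj => i; apply: (mulfI (hz i)); exact: H. Qed.

Lemma O_B_point w : O_B h z w ->
  exists u, forall i, cform e (alpha S i) u = ze z w i.
Proof.
move=> Hw; apply: (cform_onto he hh) => k; rewrite -[RHS](Hw k).
by apply: eq_bigr => i _; rewrite /ze mulrAC.
Qed.

(** The characters cancel because [\sum_i <alpha_i, lam_j> beta_i] is the image
    of [lam_j] under the composite map from [a] to [t], which is zero. *)
Lemma p_q w u j : (forall i, cform e (alpha S i) u = ze z w i) ->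
  p_ e lam j u = q_ lam z j.
Proof.
move=> Hu; rewrite /p_ /q_.
have -> : \prod_i z i ^ pairing lam i j =
    \prod_i z i ^ pairing lam i j * e_ (\sum_i beta S i *~ pairing lam i j) w.
  rewrite [X in e_ X _](_ : _ = 0) ?e_0 ?mulr1//.
  rewrite -[RHS](sum_alpha_beta (tnth lam j)); apply: eq_bigr => i _.
  by rewrite -(pairingE hlam) scaler_int.
by rewrite e_sum -big_split/=; apply: eq_bigr => i _; rewrite Hu expfzMl.
Qed.

End Points.
End Torus.

(** * Holomorphic functions and the map p *)

Section Holomorphic.
Variables (R : realType) (r : nat).
Local Notation C := R[i].
Local Notation N := (cnorm_norm R r).
Local Notation NC := (cabs_norm R).
Implicit Types (f g : 'rV[C]_r -> C) (u : 'rV[C]_r).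

(** The derivative is a complex linear form, written as a column vector. *)
Definition hol f u : Prop :=
  exists g : 'cV[C]_r, sderiv N NC f u (fun v => (v *m g) 0 0).

Lemma hol_cst (c : C) u : hol (fun=> c) u.
Proof.
exists 0; apply: sderiv_ext (sderiv_cst _ _ c u) => // v.
by rewrite mulmx0 [RHS]mxE.
Qed.

Lemma holD f g u : hol f u -> hol g u -> hol (fun x => f x + g x) u.
Proof.
move=> [a Ha] [b Hb]; exists (a + b); apply: sderiv_ext (sderivD Ha Hb) => // v.
by rewrite mulmxDr [RHS]mxE.
Qed.

Lemma holM f g u : hol f u -> hol g u -> hol (fun x => f x * g x) u.
Proof.
move=> [a Ha] [b Hb]; exists (g u *: a + f u *: b).
apply: sderiv_ext (sderivM Ha Hb) => // v.
by rewrite mulmxDr -!scalemxAr [RHS]mxE [X in _ = X + _]mxE [X in _ = _ + X]mxE mulrC.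
Qed.

Lemma holV f u : f u != 0 -> hol f u -> hol (fun x => (f x)^-1) u.
Proof.
move=> f0 [a Ha]; exists (- (f u ^- 2) *: a).
apply: sderiv_ext (sderivV f0 Ha) => // v.
by rewrite -scalemxAr [RHS]mxE !mulNr mulrC.
Qed.

Lemma hol_sum (I : Type) (s : seq I) (P : pred I) (F : I -> 'rV[C]_r -> C) u :
  (forall i, hol (F i) u) -> hol (fun x => \sum_(i <- s | P i) F i x) u.
Proof.
move=> H; elim: s => [|i s IH].
  by under eq_fun do rewrite big_nil; exact: hol_cst.
by under eq_fun do rewrite big_cons; case: (P i) => //; exact: holD.
Qed.

Lemma hol_prod (I : Type) (s : seq I) (P : pred I) (F : I -> 'rV[C]_r -> C) u :
  (forall i, hol (F i) u) -> hol (fun x => \prod_(i <- s | P i) F i x) u.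
Proof.
move=> H; elim: s => [|i s IH].
  by under eq_fun do rewrite big_nil; exact: hol_cst.
by under eq_fun do rewrite big_cons; case: (P i) => //; exact: holM.
Qed.

Lemma hol_exp f k u : hol f u -> hol (fun x => f x ^+ k) u.
Proof.
move=> H; elim: k => [|k IH].
  by under eq_fun do rewrite expr0; exact: hol_cst.
by under eq_fun do rewrite exprS; exact: holM.
Qed.

Lemma hol_det m (F : 'rV[C]_r -> 'M[C]_m) u :
  (forall i j, hol (fun x => F x i j) u) -> hol (fun x => \det (F x)) u.
Proof.
move=> H; apply: hol_sum => s; apply: holM; first exact: hol_cst.
by apply: hol_prod => i; exact: H.
Qed.

Lemma hol_meval n (P : mpoly.mpoly n C) (F : 'rV[C]_r -> 'I_n -> C) u :
  (forall i, hol (fun x => F x i) u) -> hol (fun x => mpoly.meval (F x) P) u.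
Proof.
move=> H; under eq_fun do rewrite mpoly.mevalE.
apply: hol_sum => m; apply: holM; first exact: hol_cst.
by apply: hol_prod => i; exact: hol_exp.
Qed.

Lemma hol_neq0 f u : hol f u -> f u != 0 ->
  exists2 del : R, 0 < del & forall x, cnorm (x - u) < del -> f x != 0.
Proof.
move=> [g Hg] fu0; have := sderiv_continuous Hg.
move=> /(_ (cabs (f u))); rewrite cabs_gt0 => /(_ fu0)[del del0 H].
exists del => // x /H /= fx; apply/eqP => fx0.
by move: fx; rewrite fx0 sub0r cabsN ltxx.
Qed.

(** Near [q] all derivatives are within 1 of the one at [q], in each
    coordinate. *)
Lemma hol_bounded f q (sigma : R) : 0 < sigma ->
  (forall w, cnorm (w - q) < sigma -> hol f w) ->
  exists (Gd : 'rV[C]_r -> 'cV[C]_r) (sigma' M : R), [/\ 0 < sigma' <= sigma,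
    forall w, cnorm (w - q) < sigma' ->
      sderiv N NC f w (fun v => (v *m Gd w) 0 0)
  & forall w k, cnorm (w - q) < sigma' -> cabs (Gd w k 0) <= M].
Proof.
move=> s0 H; pose Gd w := xget 0 [set g : 'cV[C]_r |
  sderiv N NC f w (fun v => (v *m g) 0 0)].
have HG w : cnorm (w - q) < sigma ->
    sderiv N NC f w (fun v => (v *m Gd w) 0 0).
  by move=> /H[g Hg]; exact: (@xgetPex _ 0 [set g | sderiv N NC f w (fun v => (v *m g) 0 0)] (ex_intro _ g Hg)).
have qq : cnorm (q - q) < sigma by rewrite subrr cnorm0.
have [del del0 Hdel] := sderiv_uniq_near (HG _ qq) s0 HG ltr01.
exists Gd, (Num.min sigma del), (1 + \sum_k cabs (Gd q k 0)); split.
- by rewrite lt_min s0 del0 ge_min lexx.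
- by move=> w; rewrite lt_min => /andP[/HG].
move=> w k; rewrite lt_min => /andP[_ /Hdel[eta eta0 Heta]].
pose v : 'rV[C]_r := (eta / 2)%:C *: delta_mx 0 k.
have e2 : 0 < eta / 2 by rewrite divr_gt0.
have vn : cnorm v <= eta / 2.
  apply/cnorm_leP => [|j]; first exact: ltW.
  rewrite !mxE eqxx /=; case: (j == k); last by rewrite mulr0 cabs0 ltW.
  by rewrite mulr1 cabs_real gtr0_norm.
have /Heta : cnorm v < eta by rewrite (le_lt_trans vn)//; lra.
have vm (g : 'cV[C]_r) : (v *m g) 0 0 = (eta / 2)%:C * g k 0.
  by rewrite /v -scalemxAl mxE -rowE mxE.
rewrite /= !vm -mulrBr cabsM cabs_real gtr0_norm// mul1r => /le_trans/(_ vn).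
rewrite -[leRHS]mulr1 ler_pM2l// => H1.
rewrite -(subrK (Gd q k 0) (Gd w k 0)) (le_trans (cabsD _ _))// lerD//.
by rewrite (bigD1 k)//= lerDl sumr_ge0// => j _; exact: cabs_ge0.
Qed.

(** The functions [p_j] are products of integer powers of linear forms, so their
    derivatives are simplest in logarithmic form. *)
Definition logderiv f u (l : 'rV[C]_r -> C) : Prop :=
  sderiv N NC f u (fun v => f u * l v).

Lemma logderivM f g u l m : logderiv f u l -> logderiv g u m ->
  logderiv (fun x => f x * g x) u (fun v => l v + m v).
Proof.
by move=> Hf Hg; apply: sderiv_ext (sderivM Hf Hg) => // v; ring.
Qed.

Lemma logderiv1 u : logderiv (fun=> 1) u (fun=> 0).
Proof. by apply: sderiv_ext (sderiv_cst _ _ 1 u) => // v; rewrite mulr0. Qed.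

Lemma logderivV f u l : f u != 0 -> logderiv f u l ->
  logderiv (fun x => (f x)^-1) u (fun v => - l v).
Proof.
by move=> f0 Hf; apply: sderiv_ext (sderivV f0 Hf) => // v; field.
Qed.

Lemma logderiv_expz f u l (m : int) : f u != 0 -> logderiv f u l ->
  logderiv (fun x => f x ^ m) u (fun v => m%:~R * l v).
Proof.
move=> f0 Hf.
have H (k : nat) : logderiv (fun x => f x ^+ k) u (fun v => k%:R * l v).
  elim: k => [|k IH].
    by apply: sderiv_ext (logderiv1 u) => // v; rewrite !mul0r.
  apply: sderiv_ext (logderivM Hf IH) => [x|v]; first by rewrite exprS.
  by rewrite exprS mulrSr; ring.
case: m => k; first exact: H.
apply: sderiv_ext (logderivV _ (H k.+1)) => [x|v|]; first by rewrite NegzE exprnN.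
  by rewrite NegzE exprnN rmorphN/= mulNr.
by rewrite expf_neq0.
Qed.

Lemma logderiv_prod (I : Type) (s : seq I) (F : I -> 'rV[C]_r -> C) u l :
  (forall i, logderiv (F i) u (l i)) ->
  logderiv (fun x => \prod_(i <- s) F i x) u (fun v => \sum_(i <- s) l i v).
Proof.
move=> H; elim: s => [|i s IH].
  by apply: sderiv_ext (logderiv1 u) => [x|v]; rewrite !big_nil.
by apply: sderiv_ext (logderivM (H i) IH) => [x|v]; rewrite !big_cons.
Qed.

End Holomorphic.

Section PMap.
Variables (R : realType) (r n d : nat) (S : lattice_seq R r n d).
Local Notation C := R[i].
Local Notation a := (sp_a S).
Local Notation N := (cnorm_norm R r).
Local Notation NC := (cabs_norm R).
Variables e lam : r.-tuple a.
Implicit Type u : 'rV[C]_r.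

Definition pmap_row u : 'rV[C]_r := \row_j p_ e lam j u.

(** The matrix of the logarithmic derivatives of the [p_j]. *)
Definition p_jac0 (u : 'rV[C]_r) : 'M[C]_r := \matrix_(k < r, j < r)
  \sum_i (alpha S i (tnth e k) : R)%:C * (pairing lam i j)%:~R / cform e (alpha S i) u.

Definition p_jac u : 'M[C]_r := \matrix_(k, j) (p_ e lam j u * p_jac0 u k j).

Lemma cform_mulmx l u :
  cform e l u = (u *m \col_k (l (tnth e k) : R)%:C) 0 0.
Proof. by rewrite mxE; apply: eq_bigr => k _; rewrite mxE mulrC. Qed.

Lemma cform_sderiv l u : sderiv N NC (cform e l) u (cform e l).
Proof.
apply: sderiv_lin; split=> [x y|]; first exact: cformB.
have [K K0 HK] := mulmx_bounded (\col_k (l (tnth e k) : R)%:C : 'cV[C]_r).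
by exists K => // v; rewrite /= cform_mulmx (le_trans (cnorm_coord _ _)).
Qed.

Lemma cform_hol l u : hol (cform e l) u.
Proof.
exists (\col_k (l (tnth e k) : R)%:C); apply: sderiv_ext (cform_sderiv l u) => // v.
by rewrite cform_mulmx.
Qed.

Lemma p_sderiv j u : U_A e u ->
  sderiv N NC (p_ e lam j) u (fun v => (v *m p_jac u) 0 j).
Proof.
move=> Uu.
have H i : logderiv (fun x => cform e (alpha S i) x ^ pairing lam i j) u
    (fun v => (pairing lam i j)%:~R * (cform e (alpha S i) v / cform e (alpha S i) u)).
  apply: logderiv_expz; first exact: Uu.
  apply: sderiv_ext (cform_sderiv _ u) => // v.
  by rewrite mulrCA mulfV ?mulr1//; exact: Uu.
apply: sderiv_ext (logderiv_prod (index_enum 'I_n) H) => // v.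
rewrite mxE; under [RHS]eq_bigr do rewrite mxE mulrCA.
rewrite -mulr_sumr; congr (_ * _).
under [RHS]eq_bigr do rewrite mxE mulr_sumr.
rewrite exchange_big; apply: eq_bigr => i _ /=.
rewrite [cform e _ v]/cform mulr_suml mulr_sumr.
by apply: eq_bigr => k _; ring.
Qed.

Lemma p_hol j u : U_A e u -> hol (p_ e lam j) u.
Proof.
move=> Uu; exists (\col_k p_jac u k j).
apply: sderiv_ext (p_sderiv j Uu) => // v.
by rewrite !mxE; apply: eq_bigr => k _; rewrite [in RHS]mxE.
Qed.

Lemma pmap_sderiv u : U_A e u ->
  sderiv N N pmap_row u (fun v => v *m p_jac u).
Proof.
move=> Uu; apply: sderiv_row => j.
apply: sderiv_ext (p_sderiv j Uu) => // x; by rewrite mxE.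
Qed.

Lemma p_jac_hol k j u : U_A e u -> hol (fun x => p_jac x k j) u.
Proof.
move=> Uu; under eq_fun do rewrite !mxE; apply: holM; first exact: p_hol.
apply: hol_sum => i; apply: holM; first exact: hol_cst.
by apply: holV; [exact: Uu|exact: cform_hol].
Qed.

Lemma det_p_jac u : \det (p_jac u) = \prod_j p_ e lam j u * \det (p_jac0 u).
Proof.
have -> : p_jac u = p_jac0 u *m diag_mx (pmap_row u).
  by apply/matrixP => k j; rewrite mul_mx_diag !mxE mulrC.
rewrite det_mulmx det_diag mulrC; congr (_ * _).
by apply: eq_bigr => j _; rewrite mxE.
Qed.

Lemma p_neq0 u j : U_A e u -> p_ e lam j u != 0.
Proof. by move=> Uu; apply/prodf_neq0 => i _; rewrite expfz_neq0//; exact: Uu. Qed.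

End PMap.

(** * Local charts and patches *)

Section HolomorphicMeanValue.
Variables (R : realType) (r : nat).
Local Notation C := R[i].

Lemma mean_value_hol (G : 'rV[C]_r -> C) q (sigma : R) : 0 < sigma ->
  (forall w, cnorm (w - q) < sigma -> hol G w) ->
  exists2 sigma' : R, 0 < sigma' & forall delta : R, 0 < delta < sigma' ->
    cube_integral (fun s => G (torus_pt q delta s)) = G q.
Proof.
move=> s0 /(hol_bounded s0)[Gd [s' [M [/andP[s'0 _] HG HM]]]].
exists s' => // delta dd; rewrite /cube_integral.
rewrite (mean_value_torus HG HM dd).
have -> : cube_Rintegral (fun s => complex.Im (G (torus_pt q delta s))) =
    cube_Rintegral (fun s => complex.Re (- 'i%C * G (torus_pt q delta s))).
  congr cube_Rintegral; apply/funext => s.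
  by case: (G _) => ? ? /=; rewrite oppr0 mul0r sub0r mulN1r opprK.
rewrite (@mean_value_torus _ _ (fun w => - 'i%C * G w) (fun w => - 'i%C *: Gd w)
  q s' M delta)//; first by case: (G q) => ? ? /=; congr (_ +i* _); ring.
- move=> w /HG H; apply: sderiv_ext (sderivM (sderiv_cst _ _ (- 'i%C) w) H) => // v.
  by rewrite mul0r add0r -scalemxAr [RHS]mxE.
- move=> w k /HM H; rewrite mxE cabsM cabsN.
  by rewrite cabs_i mul1r.
Qed.

Lemma hol_comp (G : 'rV[C]_r -> C) (g : 'rV[C]_r -> 'rV[C]_r) w (J : 'M[C]_r) :
  sderiv (cnorm_norm R r) (cnorm_norm R r) g w (fun v => v *m J) ->
  hol G (g w) -> hol (G \o g) w.
Proof.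
move=> Hg [b Hb]; exists (J *m b); apply: sderiv_ext (sderiv_comp Hg Hb) => // v.
by rewrite /= mulmxA.
Qed.

End HolomorphicMeanValue.

Section Chart.
Variables (R : realType) (r n d : nat) (S : lattice_seq R r n d).
Local Notation C := R[i].
Local Notation a := (sp_a S).
Local Notation N := (cnorm_norm R r).
Variables e lam : r.-tuple a.
Implicit Type u : 'rV[C]_r.
Local Notation p_jac := (p_jac e lam).
Local Notation pmap_row := (pmap_row e lam).

(** Where its Jacobian does not vanish, the map [p] has a local inverse, which is
    strictly differentiable at every point of a ball around [p u0]; the auxiliary
    function [F] collects what must stay nonzero near [u0]. *)
Lemma local_chart u0 (F : 'rV[C]_r -> C) : U_A e u0 ->
  \det (p_jac u0) != 0 -> hol F u0 -> F u0 != 0 ->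
  exists (rho c sigma : R) (g : 'rV[C]_r -> 'rV[C]_r),
  [/\ 0 < rho, 0 < c /\ 0 < sigma,
    forall u, cnorm (u - u0) < rho -> U_A e u /\ F u != 0,
    forall x y, cnorm (x - u0) < rho -> cnorm (y - u0) < rho ->
      c * cnorm (x - y) <= cnorm (pmap_row x - pmap_row y)
  & forall w, cnorm (w - pmap_row u0) < sigma ->
    [/\ cnorm (g w - u0) < rho, pmap_row (g w) = w, p_jac (g w) \in unitmx
      & sderiv N N g w (fun v => v *m invmx (p_jac (g w)))]].
Proof.
move=> Uu0 detn0 hF F0.
have holU : hol (fun u => \prod_i cform e (alpha S i) u) u0.
  by apply: hol_prod => i; exact: cform_hol.
have U0 : \prod_i cform e (alpha S i) u0 != 0.
  by apply/prodf_neq0 => i _; exact: Uu0.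
have [d1 d10 H1] := hol_neq0 holU U0.
have holJ : hol (fun u => \det (p_jac u)) u0.
  by apply: hol_det => i j; exact: p_jac_hol.
have [d2 d20 H2] := hol_neq0 holJ detn0.
have [d3 d30 H3] := hol_neq0 hF F0.
have d0 : 0 < Num.min d1 (Num.min d2 d3) by rewrite !lt_min d10 d20.
have uJ : p_jac u0 \in unitmx by rewrite unitmxE unitfE.
have [rho [c [sigma [/andP[rho0 rhod] c0 s0 low onto]]]] :=
  local_inverse uJ (pmap_sderiv lam Uu0) d0.
pose g w := xget u0 [set u | cnorm (u - u0) < rho /\ pmap_row u = w].
have Hg w : cnorm (w - pmap_row u0) < sigma ->
    cnorm (g w - u0) < rho /\ pmap_row (g w) = w.
  by move=> /onto[u ur uw]; exact: (@xgetPex _ u0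
    [set u | cnorm (u - u0) < rho /\ pmap_row u = w] (ex_intro _ u (conj ur uw))).
have near u : cnorm (u - u0) < rho -> [/\ U_A e u, F u != 0 & p_jac u \in unitmx].
  move=> /lt_le_trans/(_ rhod); rewrite !lt_min => /and3P[u1 u2 u3].
  split; [|exact: H3|by rewrite unitmxE unitfE H2].
  by move=> i; have /prodf_neq0 := H1 _ u1; exact.
exists rho, c, sigma, g; split=> //; first by move=> u /near[].
move=> w ws; have [gw pw] := Hg w ws; have [Ugw _ Jgw] := near _ gw.
by split=> //; apply: inverse_sderiv c0 low Hg ws Jgw (pmap_sderiv lam Ugw).
Qed.

End Chart.

Section PatchCalculus.
Variable R : realType.
Local Notation C := R[i].

Lemma rV_coord_le r (s : 'rV[R]_r) j : `|s 0 j| <= `|s|.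
Proof.
rewrite [leRHS]/Num.norm/= mx_normrE.
exact: (@le_bigmax _ _ _ 0 (fun ij : 'I_1 * 'I_r => `|s ij.1 ij.2|) (0, j)).
Qed.

(** Each coordinate turns with speed [2 pi i] times its position relative to the
    centre. *)
Lemma torus_pt_sderiv r (q : 'rV[C]_r) (delta : R) (s : 'rV[R]_r) :
  sderiv (nmod_norm 'rV[R]_r) (cnorm_norm R r) (torus_pt q delta) s
   (fun v => \row_j ((v 0 j)%:C * ((pi *+ 2)%:C * 'i%C * (delta%:C * circ (s 0 j))))).
Proof.
apply: sderiv_row => j.
have H : sderiv (nmod_norm 'rV[R]_r) (abs_norm R) (fun x : 'rV[R]_r => x 0 j) s
    (fun v : 'rV[R]_r => v 0 j).
  apply: sderiv_lin; split=> [x y|]; first by rewrite !mxE.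
  by exists 1 => // v; rewrite mul1r; exact: rV_coord_le.
have := sderivD (sderiv_cst _ _ (q 0 j) s) (sderivM (sderiv_cst _ _ delta%:C s)
  (sderiv_comp H (circ_sderiv (s 0 j)))).
apply: sderiv_ext => x; first by rewrite mxE.
by rewrite /= [RHS]mxE; ring.
Qed.

Section C1.
Variables (r : nat) (phi : 'rV[R]_r -> 'rV[C]_r).
Variable L : 'rV[R]_r -> 'rV[R]_r -> 'rV[C]_r.
Hypothesis phiL : forall s,
  sderiv (nmod_norm 'rV[R]_r) (cnorm_norm R r) phi s (L s).
Hypothesis LZ : forall s (k : R) v, L s (k *: v) = k%:C *: L s v.

Let coord_sderiv s j : sderiv (nmod_norm 'rV[R]_r) (cabs_norm R)
  (fun x => phi x 0 j) s (fun v => L s v 0 j).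
Proof.
have cj : bounded_additive (cnorm_norm R r) (cabs_norm R) (fun u : 'rV[C]_r => u 0 j).
  split=> [x y|]; first by rewrite !mxE.
  by exists 1 => // v; rewrite mul1r; exact: cnorm_coord.
exact: (sderiv_comp (phiL s) (sderiv_lin (phi s) cj)).
Qed.

Let re_sderiv s j := sderiv_comp (coord_sderiv s j) (sderiv_lin _ (Re_ba R)).
Let im_sderiv s j := sderiv_comp (coord_sderiv s j) (sderiv_lin _ (Im_ba R)).

Let re_scal s j : scalable ((fun v => complex.Re (L s v 0 j)) : 'rV[R]_r -> R^o).
Proof. by move=> k v; rewrite LZ mxE Re_scale. Qed.

Let im_scal s j : scalable ((fun v => complex.Im (L s v 0 j)) : 'rV[R]_r -> R^o).
Proof. by move=> k v; rewrite LZ mxE Im_scale. Qed.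

Lemma sderiv_C1_patch : C1_patch phi.
Proof.
move=> s _; apply: (@nearW _ (nbhs s) _ (nbhs_filter s)) => x j; split; split.
- exact: (sderiv_diff (@re_scal x j) (re_sderiv x j)).1.
- move=> k; apply: (@sderiv_derive_continuous R _ (re_part phi j) x
    (fun y v => complex.Re (L y v 0 j)) _ 1 ltr01) => y _.
  by split; [exact: re_scal|exact: re_sderiv].
- exact: (sderiv_diff (@im_scal x j) (im_sderiv x j)).1.
- move=> k; apply: (@sderiv_derive_continuous R _ (im_part phi j) x
    (fun y v => complex.Im (L y v 0 j)) _ 1 ltr01) => y _.
  by split; [exact: im_scal|exact: im_sderiv].
Qed.

Lemma sderiv_tangent s : tangent phi s = \matrix_(k, j) L s (delta_mx 0 k) 0 j.
Proof.
apply/matrixP => k j; rewrite !mxE.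
have [_ ->] := sderiv_diff (@re_scal s j) (re_sderiv s j).
have [_ ->] := sderiv_diff (@im_scal s j) (im_sderiv s j).
by rewrite /=; case: (L _ _ _ _).
Qed.

End C1.
End PatchCalculus.

(** * The cycle around one point *)

Section TorusPatch.
Variables (R : realType) (r n d : nat) (S : lattice_seq R r n d).
Local Notation C := R[i].
Local Notation a := (sp_a S).
Local Notation N := (cnorm_norm R r).
Variables (e lam : r.-tuple a) (z : 'I_n -> C) (P : mpoly.mpoly n C).
Local Notation p_jac := (p_jac e lam).
Local Notation pmap_row := (pmap_row e lam).

Definition q_row : 'rV[C]_r := \row_j q_ lam z j.

(** The coefficient that the integrated form takes when it is pulled back by a
    parametrization of the torus [|p_j - q_j| = delta] by angles: the factors
    [2 pi i (p_j - q_j)] of the velocities cancel the denominators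
    [p_j - q_j], and the inverse Jacobian of [p] remains. *)
Definition residue_density (u : 'rV[C]_r) : C :=
  ((pi *+ 2)%:C * 'i%C) ^+ r *
  (mpoly.meval (fun i => cform e (alpha S i) u) P * \prod_j p_ e lam j u /
   ((1 - cform e (kappa S) u) * \prod_i cform e (alpha S i) u * \det (p_jac u))).

Lemma residue_density_hol u : U_A e u -> 1 - cform e (kappa S) u != 0 ->
  \det (p_jac u) != 0 -> hol residue_density u.
Proof.
move=> Uu k0 J0; apply: holM; first exact: hol_cst.
apply: holM.
  apply: holM; first by apply: hol_meval => i; exact: cform_hol.
  by apply: hol_prod => j; exact: p_hol.
apply: holV.
  by rewrite !mulf_neq0//; apply/prodf_neq0 => i _; exact: Uu.
apply: holM; first apply: holM.
- apply: holD; first exact: hol_cst.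
  apply: (eq_ind (fun u => -1 * cform e (kappa S) u) (fun f => hol f u)).
    by apply: holM; [exact: hol_cst|exact: cform_hol].
  by apply/funext => v; rewrite mulN1r.
- by apply: hol_prod => i; exact: cform_hol.
- by apply: hol_det => i j; exact: p_jac_hol.
Qed.

Lemma p_derive j u v : U_A e u ->
  'D_v (p_ e lam j : 'rV[C]_r -> C^o) u = (v *m p_jac u) 0 j.
Proof.
move=> Uu; rewrite (@cderive_sderiv _ _ _ _ (\col_k p_jac u k j)).
  by rewrite !mxE; apply: eq_bigr => k _; rewrite mxE.
apply: sderiv_ext (p_sderiv lam j Uu) => // x.
by rewrite !mxE; apply: eq_bigr => k _; rewrite [in RHS]mxE.
Qed.

Lemma torus_pt_near (q : 'rV[C]_r) (delta sigma : R) s : 0 < delta < sigma ->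
  cnorm (torus_pt q delta s - q) < sigma.
Proof.
move=> /andP[d0 ds]; apply/cnorm_ltP => [|j]; first exact: lt_trans ds.
by rewrite !mxE addrC addKr cabsM circ_abs mulr1 cabs_real gtr0_norm.
Qed.

Variables (g : 'rV[C]_r -> 'rV[C]_r) (delta sigma : R).
Hypothesis ds : 0 < delta < sigma.
Hypothesis Hg : forall w, cnorm (w - q_row) < sigma ->
  [/\ U_A e (g w), pmap_row (g w) = w, p_jac (g w) \in unitmx
    & sderiv N N g w (fun v => v *m invmx (p_jac (g w)))].

Let d0 : 0 < delta. Proof. by case/andP: ds. Qed.

Definition torus_patch (s : 'rV[R]_r) := g (torus_pt q_row delta s).

Let speed (s : 'rV[R]_r) : 'rV[C]_r :=
  \row_k ((pi *+ 2)%:C * 'i%C * (delta%:C * circ (s 0 k))).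

Let Hs s := Hg (torus_pt_near q_row s ds).

Let L s (v : 'rV[R]_r) : 'rV[C]_r :=
  (\row_j ((v 0 j)%:C * speed s 0 j)) *m invmx (p_jac (torus_patch s)).

Let phiL s : sderiv (nmod_norm 'rV[R]_r) N torus_patch s (L s).
Proof.
have [_ _ _ Hgs] := Hs s.
apply: sderiv_ext (sderiv_comp (torus_pt_sderiv q_row delta s) Hgs) => // v.
rewrite /= /L; congr (_ *m _); apply/rowP => j.
by rewrite !mxE.
Qed.

Let LZ s (k : R) v : L s (k *: v) = k%:C *: L s v.
Proof.
rewrite /L scalemxAl; congr (_ *m _); apply/rowP => j.
by rewrite !mxE (rmorphM (real_complex R) k) !mulrA.
Qed.

Lemma torus_patch_C1 : C1_patch torus_patch.
Proof. exact: sderiv_C1_patch phiL LZ. Qed.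

(** The chain rule: the velocities on the torus are diagonal, and the local
    inverse of [p] contributes the inverse of its Jacobian. *)
Lemma torus_patch_tangent s : tangent torus_patch s =
  diag_mx (speed s) *m invmx (p_jac (torus_patch s)).
Proof.
rewrite (sderiv_tangent phiL LZ); apply/matrixP => k j.
rewrite mxE /L; set I := invmx _.
transitivity (row k (diag_mx (speed s) *m I) 0 j); last by rewrite mxE.
rewrite row_mul; congr ((_ *m _) _ _); apply/rowP => l.
rewrite [LHS]mxE [RHS]mxE [RHS]mxE mxE eqxx [k == l]eq_sym.
by have [->|_] := eqVneq l k; rewrite ?mul1r ?mulr1n ?mul0r ?mulr0n.
Qed.

Let p_minus_q s j : p_ e lam j (torus_patch s) - q_ lam z j =
  delta%:C * circ (s 0 j).
Proof.
have [_ /rowP/(_ j) + _ _] := Hs s; rewrite !mxE => ->.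
by rewrite addrC addKr.
Qed.

Let dcirc_neq0 (s : 'rV[R]_r) j : delta%:C * circ (s 0 j) != 0 :> C.
Proof.
rewrite mulf_neq0 ?circ_neq0// -cabs_eq0 cabs_real normr_eq0.
by rewrite gt_eqF.
Qed.

(** The form [d arg (p_j - q_j)] is [2 pi] on the j-th tangent vector and 0 on
    the others, because [p] undoes its local inverse. *)
Lemma torus_patch_oriented s :
  0 < darg_wedge e lam z (torus_patch s) (tangent torus_patch s).
Proof.
have [Us _ Js _] := Hs s.
rewrite /darg_wedge [X in \det X](_ : _ = (pi *+ 2)%:M).
  by rewrite det_scalar exprn_gt0// pmulrn_lgt0// pi_gt0.
apply/matrixP => k j; rewrite [LHS]mxE [RHS]mxE /darg.
rewrite (p_derive j _ Us) p_minus_q torus_patch_tangent -row_mul mulmxKV//.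
rewrite [X in X / _]mxE [X in X / _]mxE; have [<-|_] := eqVneq k j.
  rewrite !mulr1n mxE mulfK ?dcirc_neq0//.
  by rewrite Im_scale mulr1.
by rewrite !mulr0n mul0r.
Qed.

(** The remaining factor is [residue_density], which is holomorphic: this is
    where the poles of the integrand along [p_j = q_j] disappear. *)
Lemma torus_patch_integrand s :
  integrand e lam z P (torus_patch s) * dmu (tangent torus_patch s) =
  residue_density (torus_patch s).
Proof.
have [Us _ Js _] := Hs s.
rewrite torus_patch_tangent /dmu det_mulmx det_diag det_inv.
under eq_bigr do rewrite mxE.
rewrite big_split/= prodr_const card_ord /integrand /residue_density.
under [X in _ / (_ * X) * _]eq_bigr do rewrite p_minus_q.
have : \prod_j (delta%:C * circ (s 0 j)) != 0 :> C.
  by apply/prodf_neq0 => j _; exact: dcirc_neq0.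
set Pi := \prod_j (delta%:C * circ _) => Pi0.
set c := _ ^+ r; set num := _ * \prod_j _; set den := (1 - _) * \prod_i _.
rewrite !(invfM den); set dd := den^-1; set jj := (\det _)^-1.
transitivity (num * dd * c * jj * (Pi * Pi^-1)); first by ring.
by rewrite mulfV// mulr1; ring.
Qed.

Lemma torus_patch_inj s x : open_cube s -> open_cube x ->
  torus_patch s = torus_patch x -> s = x.
Proof.
move=> os ox E; apply/rowP => j; apply: circ_inj; [exact: os|exact: ox|].
have := p_minus_q s j; rewrite E p_minus_q => /mulfI H.
apply/esym/H; rewrite -cabs_eq0 cabs_real normr_eq0; by rewrite gt_eqF.
Qed.

End TorusPatch.

Section PointPatch.
Variables (R : realType) (r n d : nat) (S : lattice_seq R r n d).
Local Notation C := R[i].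
Local Notation a := (sp_a S).
Local Notation N := (cnorm_norm R r).
Variables (e lam : r.-tuple a) (z : 'I_n -> C) (P : mpoly.mpoly n C).
Local Notation p_jac := (p_jac e lam).
Local Notation pmap_row := (pmap_row e lam).

(** The contribution of one point.  The integral over the cycle is the mean value
    of a holomorphic function of [w = p u] on a torus centred at [q], hence its
    value at the centre [w = q], that is at [u = u0].  The data are returned as
    one tuple so that they can be chosen for all points at once. *)
Lemma point_patch u0 : U_A e u0 -> pmap_row u0 = q_row lam z ->
  1 - cform e (kappa S) u0 != 0 -> \det (p_jac u0) != 0 ->
  exists D : R * R * R * ('rV[C]_r -> 'rV[C]_r),
  let: (rho, c, sigma, g) := D in
  [/\ [/\ 0 < rho, 0 < c & 0 < sigma],
    forall u, cnorm (u - u0) < rho -> U_A e u,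
    forall x y, cnorm (x - u0) < rho -> cnorm (y - u0) < rho ->
      c * cnorm (x - y) <= cnorm (pmap_row x - pmap_row y),
    forall w, cnorm (w - q_row lam z) < sigma ->
      cnorm (g w - u0) < rho /\
      [/\ U_A e (g w), pmap_row (g w) = w, p_jac (g w) \in unitmx
      & sderiv N N g w (fun v => v *m invmx (p_jac (g w)))]
  & forall delta : R, 0 < delta < sigma ->
      cube_integral (fun s => residue_density e lam P (torus_patch lam z g delta s))
      = residue_density e lam P u0].
Proof.
move=> U0 pu0 k0 J0.
have hk : hol (fun u => 1 - cform e (kappa S) u) u0.
  apply: holD; first exact: hol_cst.
  apply: (eq_ind (fun u => -1 * cform e (kappa S) u) (fun f => hol f u0)).
    by apply: holM; [exact: hol_cst|exact: cform_hol].
  by apply/funext => v; rewrite mulN1r.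
have [rho [c [sigma [g [rho0 [c0 s0] HU low Hg]]]]] := local_chart U0 J0 hk k0.
rewrite pu0 in Hg.
have Hgw w : cnorm (w - q_row lam z) < sigma ->
    [/\ cnorm (g w - u0) < rho, U_A e (g w), 1 - cform e (kappa S) (g w) != 0
      & pmap_row (g w) = w] /\ [/\ p_jac (g w) \in unitmx, \det (p_jac (g w)) != 0
      & sderiv N N g w (fun v => v *m invmx (p_jac (g w)))].
  move=> /Hg[gr pg Jg gd]; have [Ug Fg] := HU _ gr.
  by split; split=> //; rewrite -unitfE -unitmxE.
have holQ w : cnorm (w - q_row lam z) < sigma ->
    hol (residue_density e lam P \o g) w.
  move=> /Hgw[[_ Ug kg _] [_ Jg gd]]; apply: hol_comp gd _.
  exact: residue_density_hol.
have [s' s'0 Hs'] := mean_value_hol s0 holQ.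
exists (rho, c, Num.min sigma s', g); split.
- by split=> //; rewrite lt_min s0.
- by move=> u /HU[].
- exact: low.
- move=> w; rewrite lt_min => /andP[/Hgw[[? ? ? ?] [? ? ?]] _].
  by split.
move=> delta; rewrite lt_min => /and3P[d0 _ ds].
rewrite (Hs' delta) ?d0//=; congr (residue_density _ _ _ _).
have [[gq _ _ pgq] _] : _ /\ _ := Hgw (q_row lam z) ltac:(by rewrite subrr cnorm0).
apply/eqP; rewrite -subr_eq0 -cnorm_eq0 eq_le cnorm_ge0 andbT.
have := low _ u0 gq; rewrite pgq pu0 subrr cnorm0 => /(_ rho0).
by rewrite subrr cnorm0 pmulr_rle0.
Qed.

End PointPatch.


(** * The residue formula *)

Theorem proposition4p7 (R : realType) (r n d : nat) (S : lattice_seq R r n d)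
    (e lam : r.-tuple (sp_a S)) (h : d.-tuple 'Hom(sp_t S, R^o))
    (P : mpoly.mpoly n R[i]) (z : 'I_n -> R[i])
    (hproj : projective S) (hspan : spanning S)
    (he : is_Zbasis (Gamma_a S) e)
    (hlam : is_Zbasis (Gamma_a S) lam)
    (hor : same_orientation e lam)
    (hh : is_Zbasis (dual_lattice (Gamma_t S)) h)
    (hP : homogeneous d P)
    (hz : forall i, z i != 0)
    (hfin : finite_set (O_B h z))
    (hnv : forall u, O_B_in_U h z e u ->
       (1 - cform e (kappa S) u) * D_B h (fun i => cform e (alpha S i) u) != 0) :
  exists U0 : set 'rV[R[i]]_r,
    [/\ U0 `<=` U_A e, nbhd_of (O_B_in_U h z e) U0
      & forall U : set 'rV[R[i]]_r,
          U `<=` U0 -> nbhd_of (O_B_in_U h z e) U ->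
        exists2 delta0 : R, 0 < delta0 &
          forall delta : R, 0 < delta < delta0 ->
          exists2 I : R[i],
            is_form_integral (Z_ e lam z delta `&` U) (darg_wedge e lam z)
              (fun u v => integrand e lam z P u * dmu v) I
          & bracket_B h z P = 1 / ((pi *+ 2)%:C * 'i%C) ^+ r * I].
Proof.
pose q := q_row lam z; pose pm := pmap_row e lam.
have /finite_seqP[s0 Os0] := hfin.
pose s := undup s0.
have us : uniq s by exact: undup_uniq.
have Os : O_B h z = [set` s].
  by rewrite Os0; apply/seteqP; split=> w /=; rewrite mem_undup.
pose m := size s; pose w_ (k : 'I_m) := tnth (in_tuple s) k.
have wO k : O_B h z (w_ k) by rewrite Os /= mem_tnth.
have /choice[u_ Hu] : forall k : 'I_m, exists u : 'rV[R[i]]_r,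
    forall i, cform e (alpha S i) u = ze z (w_ k) i.
  by move=> k; exact: (O_B_point he hh (wO k)).
have uU k : U_A e (u_ k) by move=> i; rewrite Hu ze_neq0.
have uO k : O_B_in_U h z e (u_ k) by split=> //; exists (w_ k).
have pu k : pm (u_ k) = q.
  by apply/rowP => j; rewrite !mxE (p_q hlam j (Hu k)).
have nv k := hnv _ (uO k).
have k0 k : 1 - cform e (kappa S) (u_ k) != 0.
  by have := nv k; rewrite mulf_eq0 negb_or => /andP[].
have D0 k : D_B h (fun i => cform e (alpha S i) (u_ k)) != 0.
  by have := nv k; rewrite mulf_eq0 negb_or => /andP[].
have gale k : \prod_i cform e (alpha S i) (u_ k) * \det (p_jac0 e lam (u_ k)) =
    D_B h (fun i => cform e (alpha S i) (u_ k)).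
  exact: (D_B_gale he hlam hor hh (uU k)).
have J0 k : \det (p_jac e lam (u_ k)) != 0.
  rewrite det_p_jac mulf_neq0//.
    by apply/prodf_neq0 => j _; exact: p_neq0.
  by have := D0 k; rewrite -gale mulf_eq0 negb_or => /andP[].
have /choice[D HD] := fun k => point_patch P (uU k) (pu k) (k0 k) (J0 k).
pose rho k := (D k).1.1.1; pose c k := (D k).1.1.2.
pose sig k := (D k).1.2; pose g k := (D k).2.
have {}HD k : [/\ [/\ 0 < rho k, 0 < c k & 0 < sig k],
    forall u, cnorm (u - u_ k) < rho k -> U_A e u,
    forall x y, cnorm (x - u_ k) < rho k -> cnorm (y - u_ k) < rho k ->
      c k * cnorm (x - y) <= cnorm (pm x - pm y),
    forall w, cnorm (w - q) < sig k -> cnorm (g k w - u_ k) < rho k /\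
      [/\ U_A e (g k w), pm (g k w) = w, p_jac e lam (g k w) \in unitmx
      & sderiv (cnorm_norm R r) (cnorm_norm R r) (g k) w
          (fun v => v *m invmx (p_jac e lam (g k w)))]
  & forall delta : R, 0 < delta < sig k ->
      cube_integral (fun s => residue_density e lam P
         (torus_patch lam z (g k) delta s)) = residue_density e lam P (u_ k)].
  by have := HD k; rewrite /rho /c /sig /g; case: (D k) => -[[? ?] ?] ?.
have rho0 k : 0 < rho k by case: (HD k) => -[].
have c0 k : 0 < c k by case: (HD k) => -[].
have sig0 k : 0 < sig k by case: (HD k) => -[].
have u_inj k l : u_ k = u_ l -> k = l.
  move=> E; apply/(tuple_uniqP (in_tuple s) us)/(ze_inj hz) => i.
  by rewrite -!Hu E.
(* All points of O_B have the same image q under p, which is injective on the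
   ball around each of them, so no ball contains another of these points. *)
have sep k l : cnorm (u_ l - u_ k) < rho k -> k = l.
  move=> lk; apply: u_inj; case: (HD k) => _ _ low _ _.
  have kk : cnorm (u_ k - u_ k) < rho k by rewrite subrr cnorm0.
  apply/eqP; rewrite eq_sym -subr_eq0 -cnorm_eq0 eq_le cnorm_ge0 andbT.
  by have := low _ _ lk kk; rewrite !pu subrr cnorm0 pmulr_rle0.
exists [set u | exists k, cnorm (u - u_ k) < rho k]; split.
- by move=> u [k /=]; case: (HD k) => _ HU _ _ _ /HU.
- move=> u [Uu [w Ow Hw]]; apply/nbhs_rowP.
  have [k wk] : exists k, w = w_ k.
    by apply/(tnthP (in_tuple s)); move: Ow; rewrite Os.
  have -> : u = u_ k by apply: (cform_inj he) => i; rewrite Hw Hu wk.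
  by exists (rho k) => // v vk; exists k.
move=> U UU0 nU.
have /choice[rho' Hrho'] : forall k, exists eps : R, 0 < eps /\
    forall v, cnorm (v - u_ k) < eps -> U v.
  by move=> k; have /nbhs_rowP[eps eps0 H] := nU _ (uO k); exists eps.
have minle (F : 'I_m -> R) k : \big[Num.min/1]_k F k <= F k by exact: bigmin_le.
(* Cycles within tau of their centres lie in U and are disjoint: the factor 1/2
   keeps two of them from meeting, as their centres are at least rho apart. *)
pose tau : R := \big[Num.min/1]_k Num.min (rho k / 2) (rho' k).
have tau0 : 0 < tau.
  apply/bigmin_gtP; split=> // k _; rewrite lt_min divr_gt0//.
  by case: (Hrho' k).
have tau_le k : tau <= rho k / 2 /\ tau <= rho' k.
  have : tau <= Num.min (rho k / 2) (rho' k) by exact: minle.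
  by rewrite le_min => /andP[].
(* The lower bound on the increments of p gives the k-th cycle a radius of at most
   delta / c k, which must stay below tau. *)
exists (\big[Num.min/1]_k Num.min (sig k) (c k * tau)).
  by apply/bigmin_gtP; split=> // k _; rewrite lt_min sig0 mulr_gt0.
move=> delta /andP[d0 dmin].
have dsig k : 0 < delta < sig k.
  rewrite d0 (lt_le_trans dmin)//.
  by rewrite (le_trans (minle _ k))// ge_min lexx.
have dtau k : 0 < delta < c k * tau.
  rewrite d0 (lt_le_trans dmin)//.
  by rewrite (le_trans (minle _ k))// ge_min lexx orbT.
pose phi k := torus_patch lam z (g k) delta.
have Hg k w : cnorm (w - q) < sig k ->
    [/\ U_A e (g k w), pm (g k w) = w, p_jac e lam (g k w) \in unitmx
      & sderiv (cnorm_norm R r) (cnorm_norm R r) (g k) w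
          (fun v => v *m invmx (p_jac e lam (g k w)))].
  by case: (HD k) => _ _ _ + _ => /[apply] -[].
have phi_near k x : cnorm (phi k x - u_ k) < tau.
  have xs := torus_pt_near q x (dsig k).
  case: (HD k) => _ _ low /(_ _ xs)[gr [_ pg _ _]] _.
  have kk : cnorm (u_ k - u_ k) < rho k by rewrite subrr cnorm0.
  rewrite -(ltr_pM2l (c0 k)) (le_lt_trans (low _ _ gr kk))//.
  by rewrite pg pu torus_pt_near.
have phi_p k x : pm (phi k x) = torus_pt q delta x.
  by have [_ -> _ _] := Hg k _ (torus_pt_near q x (dsig k)).
exists (\sum_k cube_integral (fun x => integrand e lam z P (phi k x) *
   dmu (tangent (phi k) x))).
  exists m, phi; split=> //; split.
  - by move=> k; exact: torus_patch_C1 (dsig k) (Hg k).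
  - apply/seteqP; split=> [v [[Uv pv] /UU0[k vk]]|v [k _ [x _ <-]]].
      have /choice[x Hx] : forall j, exists x : R, 0 <= x <= 1 /\
          p_ e lam j v - q_ lam z j = delta%:C * circ x.
        move=> j; have [|x x01 xE] := @circ_onto R (delta%:C^-1 * (p_ e lam j v - q_ lam z j)).
          apply: complexI; rewrite cabsM cabsV rmorphM fmorphV/= !cabsE pv.
          rewrite normc_def/= expr0n/= addr0 sqrtr_sqr gtr0_norm// mulVf//.
          by rewrite gt_eqF// ltcR.
        exists x; split=> //; rewrite -xE mulrA mulfV ?mul1r//.
        by rewrite gt_eqF// ltcR.
      exists k => //; exists (\row_j x j); first by move=> j; rewrite mxE; case: (Hx j).
      have vE : pm v = torus_pt q delta (\row_j x j).
        apply/rowP => j; rewrite !mxE; case: (Hx j) => _ <-.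
        by rewrite addrC subrK.
      case: (HD k) => _ _ low _ _; apply/eqP; rewrite -subr_eq0 -cnorm_eq0.
      rewrite eq_le cnorm_ge0 andbT -(pmulr_rle0 _ (c0 k)).
      have pk : cnorm (phi k (\row_j x j) - u_ k) < rho k.
        rewrite (lt_trans (phi_near _ _))// (le_lt_trans (tau_le k).1)//.
        by have := rho0 k; lra.
      by rewrite (le_trans (low _ _ pk vk))// phi_p vE subrr cnorm0.
    have [Ug pg _ _] := Hg k _ (torus_pt_near q x (dsig k)); split.
      split=> // j; have /rowP/(_ j) := pg; rewrite !mxE => ->.
      rewrite addrC addKr -cabsE cabsM circ_abs mulr1 cabs_real.
      by rewrite gtr0_norm.
    by case: (Hrho' k) => _; apply; rewrite (lt_le_trans (phi_near _ _))// (tau_le k).2.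
  - move=> k l x y ox oy E; have kl : k = l.
      apply: sep; rewrite (le_lt_trans (snorm_tri (cnorm_norm R r) _ (phi l y) _))//=.
      have := phi_near k x; have := phi_near l y; rewrite -E -cnormN opprB.
      by have := (tau_le k).1; lra.
    split=> //; move: E; rewrite -kl.
    exact: (torus_patch_inj (dsig k) (Hg k) ox oy).
  - by move=> k x _; exact: torus_patch_oriented (dsig k) (Hg k) x.
rewrite /bracket_B Os -fsbig_seq// big_tnth mulr_sumr; apply: eq_bigr => k _.
rewrite -/(w_ k).
have -> : cube_integral (fun x => integrand e lam z P (phi k x) *
    dmu (tangent (phi k) x)) = residue_density e lam P (u_ k).
  case: (HD k) => _ _ _ _ /(_ _ (dsig k)) <-; congr cube_integral.
  by apply/funext => x; exact: (torus_patch_integrand P (dsig k) (Hg k)).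
have pi0 : (pi *+ 2)%:C * 'i%C != 0 :> R[i].
  rewrite mulf_neq0//; last by rewrite eq_complex/= oner_eq0 andbF.
  by rewrite -cabs_eq0 cabs_real normr_eq0 gt_eqF// pmulrn_lgt0// pi_gt0.
rewrite /residue_density mulrA mul1r mulVf ?expf_neq0// mul1r.
have -> : ze z (w_ k) = fun i => cform e (alpha S i) (u_ k).
  by apply/funext => i; rewrite Hu.
have -> : f_ z (w_ k) = 1 - cform e (kappa S) (u_ k).
  by rewrite cform_kappa /f_; congr (1 - _); apply: eq_bigr => i _; rewrite Hu.
have x0 : \prod_i cform e (alpha S i) (u_ k) != 0.
  by apply/prodf_neq0 => i _; exact: uU.
have p0 : \prod_j p_ e lam j (u_ k) != 0.
  by apply/prodf_neq0 => j _; exact: p_neq0.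
have j0 : \det (p_jac0 e lam (u_ k)) != 0.
  by have := D0 k; rewrite -gale mulf_eq0 negb_or => /andP[].
rewrite -gale det_p_jac; have := k0 k.
set K := 1 - _ => K0; set X := \prod_i _ in x0 *; set Y := \prod_j _ in p0 *.
set J := \det _ in j0 *.
by field; rewrite K0 x0 p0 j0.
Qed.
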